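(* For every $1\le q<\infty$ with $q\ne2$, the space $L_q([0,1])$ contains a subspace without local unconditional structure but which admits a 2-dimensional unconditional decomposition; this subspace has the Gordon--Lewis property.
   Context: Local unconditional structure: a Banach space $Y$ has local unconditional structure if there is $C\ge1$ such that for every finite-dimensional subspace $Y_0\subset Y$ there exist a Banach space $F$ with a 1-unconditional basis and operators $u_0:Y_0\to F$, $w_0:F\to Y$ such that $w_0u_0$ is the natural embedding $Y_0\to Y$ and $\|u_0\|\,\|w_0\|\le C$. (A basis $\{e_j\}$ is 1-unconditional if $\|\sum_j\varepsilon_jt_je_j\|\le\|\sum_jt_je_j\|$ for all vectors $\sum_j t_je_j$ and all signs $\varepsilon_j=\pm1$.) 2-dimensional unconditional decomposition: a Schauder decomposition $\{Z_k\}_k$ with $\dim Z_k=2$ for all $k$, for which there is a constant $C$ such that $\|\sum_k\varepsilon_kz_k\|\le C\|\sum_kz_k\|$ for all finite sequences $z_k\in Z_k$ and all signs $\varepsilon_k=\pm1$. Gordon--Lewis property: a Banach space $Y$ has it if every absolutely summing operator from $Y$ to $\ell_2$ factors through an $L_1$-space. Subspaces are closed. *)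

(* Defs.v *)
From HB Require Import structures.
From mathcomp Require Import all_boot all_order all_algebra.
From mathcomp Require Import all_classical all_reals all_analysis.
From mathcomp Require Import measurable_realfun ess_sup_inf.

Set Implicit Arguments.
Unset Strict Implicit.
Unset Printing Implicit Defensive.

Import Order.TTheory GRing.Theory Num.Theory.
Import numFieldNormedType.Exports.

Local Open Scope classical_set_scope.
Local Open Scope ring_scope.

(* The library's [LspaceType mu p1], the type of a.e.-classes of measurable
   functions with finite p-norm, carries no algebraic or normed structure.
   It is made a normed space here, by operating on representatives in
   [LfunType mu p1]. *)
Section LspaceNormed.
Context d (T : measurableType d) (R : realType).
Variables (mu : {measure set T -> \bar R}) (p : \bar R) (p1 : (1 <= p)%E).

Local Notation Lf := (LfunType mu p1).
Local Notation Ls := (LspaceType mu p1).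
Local Notation Mq := {mfun_ mu, T >-> measurableTypeR R}.

HB.instance Definition _ := gen_eqMixin Ls.
HB.instance Definition _ := gen_choiceMixin Ls.

Lemma Lnorm_ae_eq (f g : T -> R) :
  measurable_fun [set: T] f -> measurable_fun [set: T] g -> f = g %[ae mu] ->
  ('N[mu]_p[EFin \o f] = 'N[mu]_p[EFin \o g])%E.
Proof.
move=> mf mg fg; rewrite unlock /Lnorm; case: p p1 => [r r1|_|//].
- have mpow (h : T -> R) : measurable_fun [set: T] h ->
      measurable_fun [set: T]
        ((fun y : \bar R => y `^ r)%E \o (abse \o (EFin \o h))).
    move=> mh; apply: (measurableT_comp (measurable_poweR _)).
    by apply: measurableT_comp => //; exact/measurable_EFinP.
  congr (_ `^ _)%E; apply: ae_eq_integral => //; [exact: mpow|exact: mpow|].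
  by apply: filterS fg => x /(_ I) fgx _ /=; rewrite fgx.
- case: ifPn => // _; apply: eq_ess_sup.
  by apply: filterS fg => x /(_ I) fgx /=; rewrite fgx.
Qed.

(* [Mq] is built on [measurableTypeR R], [Lf] on [R]: the same sigma-algebra
   under two different displays, whence the repackaging below. *)
Lemma Lrepr_subproof (x : Ls) : (repr (x : Mq) : T -> R) \in Lfun mu p.
Proof.
apply/andP; split; rewrite inE; last exact: Lebesgue_finite.
exact: (@measurable_funPT _ _ _ _ (repr (x : Mq))).
Qed.

Definition Lrepr (x : Ls) : Lf := Lfun_Sub p1 (Lrepr_subproof x).

Lemma Lmfun_subproof (f : Lf) :
  @isMeasurableFun _ _ T (measurableTypeR R) (f : T -> R).
Proof. by split; exact: (@measurable_funPT _ _ _ _ f). Qed.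

Definition Lmfun (f : Lf) : {mfun T >-> measurableTypeR R} :=
  MeasurableFun.Pack (MeasurableFun.Class (Lmfun_subproof f)).

Lemma Lmq_subproof (f : Lf) :
  (repr (\pi_(Mq)%qT (Lmfun f)) : T -> R) = f %[ae mu].
Proof.
suff /eqmodP/asboolP : repr (\pi_(Mq)%qT (Lmfun f)) = Lmfun f %[mod Mq]%qT by [].
by rewrite reprK.
Qed.

Lemma Lclass_subproof (f : Lf) :
  isFinLebesgue d T R mu p p1 (\pi_(Mq)%qT (Lmfun f)).
Proof.
split; rewrite /finite_norm.
have -> : ('N[mu]_p[EFin \o repr (\pi_(Mq)%qT (Lmfun f))] =
           'N[mu]_p[EFin \o (f : T -> R)])%E.
  apply: Lnorm_ae_eq (Lmq_subproof f).
    exact: (@measurable_funPT _ _ _ _ (repr (\pi_(Mq)%qT (Lmfun f)))).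
  exact: (@measurable_funPT _ _ _ _ f).
exact: Lfunction_finite.
Qed.

Definition Lclass (f : Lf) : Ls :=
  LebesgueSpace.Pack (LebesgueSpace.Class (Lclass_subproof f)).

Lemma Lspace_eq (x y : Ls) : x = y :> Mq -> x = y.
Proof.
case: x y => [x [[hx]]] [y [[hy]]] /= xy; move: hx hy; rewrite xy => hx hy.
by rewrite (Prop_irrelevance hx hy).
Qed.

Lemma Lrepr_class (f : Lf) : Lrepr (Lclass f) = f %[ae mu].
Proof. exact: Lmq_subproof. Qed.

Lemma LclassP (f g : Lf) : Lclass f = Lclass g <-> f = g %[ae mu].
Proof.
split=> [fg|fg].
  have := Lrepr_class f; rewrite fg => /ae_eq_sym fr.
  exact: ae_eq_trans fr (Lrepr_class g).
by apply: Lspace_eq => /=; apply/eqmodP/asboolP.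
Qed.

Lemma LreprK : cancel Lrepr Lclass.
Proof.
move=> x; apply: Lspace_eq => /=; rewrite -[RHS]reprK; congr (\pi_(Mq)%qT _).
exact/mfuneqP.
Qed.


Lemma LreprP (x y : Ls) : Lrepr x = Lrepr y %[ae mu] -> x = y.
Proof. by move/LclassP; rewrite !LreprK. Qed.

Definition Lspace_add (x y : Ls) : Ls := Lclass (Lrepr x + Lrepr y).
Definition Lspace_opp (x : Ls) : Ls := Lclass (- Lrepr x).
Definition Lspace_scale (a : R) (x : Ls) : Ls := Lclass (a *: Lrepr x).

Lemma Lclass_add (f g : Lf) : Lspace_add (Lclass f) (Lclass g) = Lclass (f + g).
Proof.
apply/LclassP; apply: filterS2 (Lrepr_class f) (Lrepr_class g) => x.
by move=> /(_ I) fx /(_ I) gx _ /=; congr (_ + _).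
Qed.

Lemma Lclass_opp (f : Lf) : Lspace_opp (Lclass f) = Lclass (- f).
Proof.
apply/LclassP; apply: filterS (Lrepr_class f) => x /(_ I) fx _ /=.
by congr (- _).
Qed.

Lemma Lclass_scale a (f : Lf) : Lspace_scale a (Lclass f) = Lclass (a *: f).
Proof.
apply/LclassP; apply: filterS (Lrepr_class f) => x /(_ I) fx _ /=.
by congr (_ * _).
Qed.

Lemma Lspace_addA : associative Lspace_add.
Proof.
move=> x y z; rewrite -[x]LreprK -[y]LreprK -[z]LreprK.
by rewrite !Lclass_add addrA.
Qed.

Lemma Lspace_addC : commutative Lspace_add.
Proof. by move=> x y; rewrite /Lspace_add addrC. Qed.

Lemma Lspace_add0 : left_id (Lclass 0) Lspace_add.
Proof. by move=> x; rewrite -[x]LreprK Lclass_add add0r. Qed.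

Lemma Lspace_addN : left_inverse (Lclass 0) Lspace_opp Lspace_add.
Proof. by move=> x; rewrite -[x]LreprK Lclass_opp Lclass_add addNr. Qed.

HB.instance Definition _ := GRing.isZmodule.Build Ls
  Lspace_addA Lspace_addC Lspace_add0 Lspace_addN.

Lemma Lspace_scaleA a b x :
  Lspace_scale a (Lspace_scale b x) = Lspace_scale (a * b) x.
Proof. by rewrite -[x]LreprK !Lclass_scale scalerA. Qed.

Lemma Lspace_scale1 : left_id 1 Lspace_scale.
Proof. by move=> x; rewrite -[x]LreprK Lclass_scale scale1r. Qed.

Lemma Lspace_scaleDr : right_distributive Lspace_scale +%R.
Proof.
move=> a x y; rewrite -[x]LreprK -[y]LreprK.
by rewrite [_ + _]Lclass_add !Lclass_scale [RHS]Lclass_add scalerDr.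
Qed.

Lemma Lspace_scaleDl x : {morph Lspace_scale^~ x : a b / a + b}.
Proof.
move=> a b; rewrite -[x]LreprK.
by rewrite !Lclass_scale [RHS]Lclass_add scalerDl.
Qed.

HB.instance Definition _ := GRing.Zmodule_isLmodule.Build R Ls
  Lspace_scaleA Lspace_scale1 Lspace_scaleDr Lspace_scaleDl.

Definition Lspace_norm (x : Ls) : R := fine ('N[mu]_p[EFin \o Lrepr x])%E.

Lemma Lspace_norm_class (f : Lf) :
  Lspace_norm (Lclass f) = fine ('N[mu]_p[EFin \o f])%E.
Proof.
congr fine; apply: Lnorm_ae_eq (Lrepr_class f).
  exact: (@measurable_funPT _ _ _ _ (Lrepr _)).
exact: (@measurable_funPT _ _ _ _ f).
Qed.

Lemma Lspace_normD x y : Lspace_norm (x + y) <= Lspace_norm x + Lspace_norm y.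
Proof.
rewrite -[x]LreprK -[y]LreprK [_ + _]Lclass_add !Lspace_norm_class.
exact: ler_LnormD.
Qed.

Lemma Lspace_normZ (a : R) x : Lspace_norm (a *: x) = `|a| * Lspace_norm x.
Proof.
rewrite -[x]LreprK [_ *: _]Lclass_scale !Lspace_norm_class.
by apply: EFin_inj; rewrite EFinM !finite_norm_fine LnormZ.
Qed.

Lemma Lspace_norm0_eq0 x : Lspace_norm x = 0 -> x = 0.
Proof.
rewrite -[x]LreprK Lspace_norm_class => /fine_Lnormr_eq0 x0.
exact/LclassP.
Qed.

HB.instance Definition _ := Lmodule_isNormed.Build R Ls
  Lspace_normD Lspace_normZ Lspace_norm0_eq0.

End LspaceNormed.

(* [submodClosed E] is the type of linear subspaces of [E], not necessarily
   topologically closed; closedness is a separate condition below. *)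

Section LinSubspace.
Context (R : realType) (E : normedModType R).

Definition linsub (V : submodClosed E) : Type := {x : E | x \in V}.

Variable V : submodClosed E.

HB.instance Definition _ := SubChoice.on (linsub V).
HB.instance Definition _ := [SubChoice_isSubLmodule of linsub V by <:].

Definition linsub_norm (x : linsub V) : R := `|val x|.

Lemma linsub_normD x y : linsub_norm (x + y) <= linsub_norm x + linsub_norm y.
Proof. by rewrite /linsub_norm raddfD ler_normD. Qed.

Lemma linsub_normZ (a : R) x : linsub_norm (a *: x) = `|a| * linsub_norm x.
Proof. by rewrite /linsub_norm linearZ /= normrZ. Qed.

Lemma linsub_norm0_eq0 x : linsub_norm x = 0 -> x = 0.
Proof. by move=> /normr0_eq0 x0; apply: val_inj; rewrite x0 raddf0. Qed.

HB.instance Definition _ := Lmodule_isNormed.Build R (linsub V)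
  linsub_normD linsub_normZ linsub_norm0_eq0.

Definition has_dim (n : nat) : Prop :=
  exists e : 'I_n -> E,
    (forall c : 'I_n -> R, \sum_i c i *: e i = 0 -> forall i, c i = 0) /\
    (forall x, x \in V <-> exists c : 'I_n -> R, x = \sum_i c i *: e i).

Definition finite_dimensional : Prop := exists n, has_dim n.

End LinSubspace.

Definition opnorm (R : realType) (X Y : normedModType R) (u : X -> Y) : R :=
  sup [set `|u x| | x in [set x : X | `|x| <= 1]].

Section Bases.
Context (R : realType) (F : normedModType R).

(* The basis is [(e j)] for [j] in [D], in increasing order of [j]: this covers
   finite ([D = `I_n]) as well as infinite ([D = setT]) bases. *)
Definition coefs_on (D : set nat) (t : nat -> R) : Prop :=
  forall j, ~ D j -> t j = 0.

Definition schauder_basis (D : set nat) (e : nat -> F) : Prop :=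
  forall x : F, exists! t : nat -> R,
    coefs_on D t /\ series (fun j => t j *: e j) @ \oo --> x.

Definition unconditional1 (D : set nat) (e : nat -> F) : Prop :=
  forall (t : nat -> R) (s : nat -> bool), coefs_on D t ->
    cvgn (series (fun j => t j *: e j)) ->
    cvgn (series (fun j => (-1) ^+ s j *: (t j *: e j))) /\
    `|limn (series (fun j => (-1) ^+ s j *: (t j *: e j)))| <=
      `|limn (series (fun j => t j *: e j))|.

Definition has_1unconditional_basis : Prop :=
  exists (D : set nat) (e : nat -> F), schauder_basis D e /\ unconditional1 D e.

End Bases.

Definition local_unconditional_structure (R : realType) (Y : normedModType R) :
    Prop :=
  exists2 C : R, 1 <= C &
    forall Y0 : submodClosed Y, finite_dimensional Y0 ->
      exists (F : completeNormedModType R)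
             (u0 : {linear linsub Y0 -> F}) (w0 : {linear F -> Y}),
        [/\ has_1unconditional_basis F,
            continuous u0, continuous w0,
            forall y : linsub Y0, w0 (u0 y) = val y &
            opnorm u0 * opnorm w0 <= C].

Section Decompositions.
Context (R : realType) (Y : normedModType R).

Definition schauder_decomposition (Z : nat -> submodClosed Y) : Prop :=
  (forall k, closed [set` Z k]) /\
  forall y : Y, exists! z : nat -> Y,
    (forall k, z k \in Z k) /\ series z @ \oo --> y.

Definition unconditional_decomposition (Z : nat -> submodClosed Y) : Prop :=
  schauder_decomposition Z /\
  exists C : R, forall (n : nat) (z : nat -> Y) (s : nat -> bool),
    (forall k, z k \in Z k) ->
    `|\sum_(k < n) (-1) ^+ s k *: z k| <= C * `|\sum_(k < n) z k|.

Definition has_2dim_unconditional_decomposition : Prop :=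
  exists Z : nat -> submodClosed Y,
    (forall k, has_dim (Z k) 2) /\ unconditional_decomposition Z.

End Decompositions.

Section GordonLewis.
Context (R : realType).

(* The supremum ranges over the unit ball of the dual of [X]. *)
Definition weak_l1_norm (X : normedModType R) (n : nat) (x : 'I_n -> X) : R :=
  sup [set r | exists2 f : {linear X -> R^o},
                 (forall y, `|f y| <= `|y|) & r = \sum_i `|f (x i)|].

Definition absolutely_summing (X Y : normedModType R) (u : {linear X -> Y}) :
    Prop :=
  exists C : R, forall (n : nat) (x : 'I_n -> X),
    \sum_i `|u (x i)| <= C * weak_l1_norm x.

Definition ell2 := LspaceType2 (@counting nat R).

Definition factors_through_L1 (X Y : normedModType R) (u : X -> Y) : Prop :=
  exists (d : measure_display) (T : measurableType d)
         (mu : {measure set T -> \bar R})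
         (a : {linear X -> LspaceType1 mu}) (b : {linear LspaceType1 mu -> Y}),
    [/\ continuous a, continuous b & forall x, u x = b (a x)].

Definition gordon_lewis (Y : normedModType R) : Prop :=
  forall u : {linear Y -> ell2},
    continuous u -> absolutely_summing u -> factors_through_L1 u.

End GordonLewis.

(* A measure on the whole line that vanishes outside [0,1]: its L_q space is
   L_q([0,1]). *)
Definition lebesgue01 (R : realType) :
    {measure set (measurableTypeR R) -> \bar R} :=
  mrestr (@lebesgue_measure R) (measurable_itv `[0, 1]).

(* Main.v *)
Require Import Defs.
From HB Require Import structures.
From mathcomp Require Import all_boot all_order all_algebra.
From mathcomp Require Import all_classical all_reals all_analysis.
From mathcomp Require Import measurable_realfun.
From mathcomp Require finmap.
From mathcomp Require Import zify ring lra.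

(* Index 2-dimensional blocks Z_k = span (e_k0, e_k1) by k in N^3 and give them
   three "components" G_0, G_1, G_2 in L_q: e_k0 = G_0k + G_2k and
   e_k1 = G_1k + G_2k, where G_mk is a normalised Rademacher function carried by
   a dyadic cell that depends on m and on a label of k.  Changing the sign of a
   block amounts to flipping a binary digit of the variable, which preserves
   Lebesgue measure: the decomposition is 1-unconditional.  Components with the
   same label span an l_2, those with distinct labels an l_q.  The labels are
   chosen so that along a line of N^3 in direction m the component G_m spans one
   of these two spaces and the two other components span the other one: the
   label of G_m is the m-th coordinate if q < 2, and the pair of the other
   coordinates if q > 2.

   If the span had local unconditional structure, a factorisation w u through a
   space with a 1-unconditional basis (b_j) would decompose the identity of each
   block into rank one 2 x 2 matrices A_kj whose traces sum to 2.  The trace of a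
   rank one matrix is controlled by three entries: for each m, the m-th component
   of the image of the vector of the block that has no m-th component.  By
   Khintchine's inequality and the 1-unconditionality of (b_j), the absolute
   values of the m-th entries sum, over all j and over the k in a line of length
   n in direction m, to at most a constant times n^(1/2) n^(1 - 1/q) (if q < 2)
   or n^(1/q) n^(1/2) (if q > 2).  Both are o(n), whereas the traces force at
   least a constant times n on average over the lines of the three directions.

   For the Gordon-Lewis property, an absolutely summing u satisfies
   sum_k |u z_k| <= C |sum_k z_k| since the blocks are unconditional, and each
   u Z_k, being of dimension at most 2, factors through l_1 uniformly. *)

Set Implicit Arguments.
Unset Strict Implicit.
Unset Printing Implicit Defensive.

Import Order.TTheory GRing.Theory Num.Theory.
Import numFieldNormedType.Exports.

Local Open Scope classical_set_scope.
Local Open Scope ring_scope.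

(** * Random signs *)

Section SignAverages.
Context {R : realType}.
Implicit Types (a b : nat -> R) (s : nat -> bool) (phi psi : (nat -> bool) -> R).

Definition set_sign s n (c : bool) : nat -> bool :=
  fun k => if k == n then c else s k.

Fixpoint sign_avg n phi : R :=
  if n is m.+1 then
    (sign_avg m (fun s => phi (set_sign s m true)) +
     sign_avg m (fun s => phi (set_sign s m false))) / 2
  else phi xpred0.

Definition signed_sum n a s : R := \sum_(k < n) (-1) ^+ s k * a k.

Lemma signed_sumS n a s :
  signed_sum n.+1 a s = signed_sum n a s + (-1) ^+ s n * a n.
Proof. by rewrite /signed_sum big_ord_recr. Qed.

Lemma signed_sum_set n a s c :
  signed_sum n a (set_sign s n c) = signed_sum n a s.
Proof.
by apply: eq_bigr => k _; rewrite /set_sign ifN// neq_ltn ltn_ord.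
Qed.

Lemma sign_avg_linear n (x : R) phi psi :
  sign_avg n (fun s => x * phi s + psi s) = x * sign_avg n phi + sign_avg n psi.
Proof. by elim: n phi psi => //= n IH phi psi; rewrite !IH; field. Qed.

Lemma sign_avg_cst n (x : R) : sign_avg n (fun=> x) = x.
Proof. by elim: n => //= n ->; field. Qed.

Lemma sign_avgZ n (x : R) phi :
  sign_avg n (fun s => x * phi s) = x * sign_avg n phi.
Proof.
have := sign_avg_linear n x phi (fun=> 0); rewrite sign_avg_cst addr0 => <-.
by congr sign_avg; apply/funext => s; rewrite addr0.
Qed.

Lemma sign_avgD n phi psi :
  sign_avg n (fun s => phi s + psi s) = sign_avg n phi + sign_avg n psi.
Proof.
have := sign_avg_linear n 1 phi psi; rewrite mul1r => <-.
by congr sign_avg; apply/funext => s; rewrite mul1r.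
Qed.

Lemma sign_avg_sum n J (F : nat -> (nat -> bool) -> R) :
  sign_avg n (fun s => \sum_(j < J) F j s) = \sum_(j < J) sign_avg n (F j).
Proof.
elim: J => [|J IH].
  rewrite big_ord0 -[RHS](sign_avg_cst n); congr sign_avg; apply/funext => s.
  by rewrite big_ord0.
rewrite big_ord_recr/= -IH -sign_avgD; congr sign_avg; apply/funext => s.
by rewrite big_ord_recr.
Qed.

Lemma ler_sign_avg n phi psi :
  (forall s, phi s <= psi s) -> sign_avg n phi <= sign_avg n psi.
Proof.
elim: n phi psi => //= n IH phi psi le_phi.
by rewrite ler_pM2r ?invr_gt0// lerD// IH.
Qed.

Lemma sign_avgS n a (h : R -> R) :
  sign_avg n.+1 (h \o signed_sum n.+1 a) =
  sign_avg n (fun s => (h (signed_sum n a s + a n) +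
                        h (signed_sum n a s - a n)) / 2).
Proof.
pose H c := fun s => h (signed_sum n a s + c).
rewrite [RHS](_ : _ = sign_avg n (fun s => 2^-1 * (H (- a n) s + H (a n) s))).
  rewrite sign_avgZ sign_avgD /= mulrC; congr (_ * (_ + _)); congr sign_avg.
    apply/funext => s; rewrite signed_sumS signed_sum_set /H /set_sign eqxx.
    by rewrite expr1 mulN1r.
  apply/funext => s; rewrite signed_sumS signed_sum_set /H /set_sign eqxx.
  by rewrite expr0 mul1r.
by congr sign_avg; apply/funext => s; rewrite /H mulrC addrC.
Qed.

Lemma sign_avg_sqr n a :
  sign_avg n (fun s => signed_sum n a s ^+ 2) = \sum_(k < n) a k ^+ 2.
Proof.
elim: n => [|n IH] /=; first by rewrite /signed_sum !big_ord0 expr0n.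
rewrite -[LHS]/(sign_avg n.+1 ((fun x => x ^+ 2) \o signed_sum n.+1 a)).
rewrite sign_avgS big_ord_recr/= -IH.
rewrite -[X in _ + X](sign_avg_cst n) -sign_avgD.
by congr sign_avg; apply/funext => s; field.
Qed.

Lemma sign_avg_pow4 n a :
  sign_avg n (fun s => signed_sum n a s ^+ 4) <= 3 * (\sum_(k < n) a k ^+ 2) ^+ 2.
Proof.
elim: n => [|n IH] /=; first by rewrite /signed_sum !big_ord0 !expr0n mulr0.
rewrite -[leLHS]/(sign_avg n.+1 ((fun x => x ^+ 4) \o signed_sum n.+1 a)).
rewrite sign_avgS big_ord_recr/=.
have -> : (fun s => ((signed_sum n a s + a n) ^+ 4 +
                     (signed_sum n a s - a n) ^+ 4) / 2) =
  (fun s => 6 * a n ^+ 2 * signed_sum n a s ^+ 2 +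
            (1 * signed_sum n a s ^+ 4 + a n ^+ 4)).
  by apply/funext => s; field.
rewrite sign_avg_linear sign_avg_linear sign_avg_cst sign_avg_sqr.
have : 0 <= a n ^+ 4 by rewrite -[4%N]/(2 * 2)%N exprM sqr_ge0.
move: IH; move: (sign_avg _ _) (\sum_(k < n) _) => u v; nra.
Qed.

(* [y^4 - 3 y^2 + 2 y = y (y - 1)^2 (y + 2) >= 0], applied to a multiple [y] of
   the sum, bounds the first moment from below by the second and the fourth. *)
Lemma khintchine n a :
  Num.sqrt (\sum_(k < n) a k ^+ 2) <=
  2 * sign_avg n (fun s => `|signed_sum n a s|).
Proof.
set v := \sum_(k < n) _; have v0 : 0 <= v by apply: sumr_ge0 => k _; exact: sqr_ge0.
have [->|vn0] := eqVneq v 0.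
  rewrite sqrtr0 mulr_ge0// -[leLHS](sign_avg_cst n); exact: ler_sign_avg.
have s0 : 0 < Num.sqrt v by rewrite sqrtr_gt0 lt0r vn0.
set t := (2 * Num.sqrt v)^-1.
have t0 : 0 < t by rewrite invr_gt0 mulr_gt0.
have tv : t * Num.sqrt v = 2^-1 by rewrite /t; field; rewrite gt_eqF.
have t2v : t ^+ 2 * v = 4^-1.
  by rewrite -[in LHS](sqr_sqrtr v0) -exprMn tv; field.
have lower : sign_avg n (fun s => 3 * t ^+ 2 * signed_sum n a s ^+ 2 +
      - t ^+ 4 * signed_sum n a s ^+ 4) <=
    2 * t * sign_avg n (fun s => `|signed_sum n a s|).
  rewrite -sign_avgZ; apply: ler_sign_avg => s; set S := signed_sum n a s.
  have -> : S ^+ 2 = `|S| ^+ 2 by rewrite -normrX ger0_norm ?sqr_ge0.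
  have -> : S ^+ 4 = `|S| ^+ 4.
    by rewrite -normrX ger0_norm// -[4%N]/(2 * 2)%N exprM sqr_ge0.
  have y0 : 0 <= t * `|S| by rewrite mulr_ge0// ltW.
  have : 0 <= (t * `|S|) * (t * `|S| - 1) ^+ 2 * (t * `|S| + 2).
    apply: mulr_ge0; last exact: addr_ge0.
    by apply: mulr_ge0 => //; exact: sqr_ge0.
  by move: `|S| => x; lra.
rewrite sign_avg_linear sign_avgZ sign_avg_sqr -/v in lower.
have tv3 : 3 * t ^+ 2 * v = 3 / 4 by rewrite -mulrA t2v.
have := sign_avg_pow4 n a; rewrite -/v => upper.
rewrite -(ler_pM2l t0) tv.
have : t ^+ 4 * sign_avg n (fun s => signed_sum n a s ^+ 4) <= 3 * 4^-1 ^+ 2.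
  rewrite -t2v exprMn -exprM mulrCA ler_pM2l//; exact: exprn_gt0.
by move: lower; rewrite tv3; move: (sign_avg _ _) (sign_avg _ _) => x y; lra.
Qed.

End SignAverages.

Section CauchySchwarz.
Context {R : realType}.

Lemma sum_normM_le_sqrt n (a b : nat -> R) :
  \sum_(k < n) `|a k| * `|b k| <=
  Num.sqrt (\sum_(k < n) a k ^+ 2) * Num.sqrt (\sum_(k < n) b k ^+ 2).
Proof.
rewrite -sqrtrM; last by apply: sumr_ge0 => k _; exact: sqr_ge0.
rewrite -[leLHS]ger0_norm; last by apply: sumr_ge0 => k _; rewrite mulr_ge0.
rewrite -sqrtr_sqr ler_wsqrtr//.
elim: n => [|n IH]; first by rewrite !big_ord0 expr0n mulr0.
rewrite !big_ord_recr/=.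
have A0 : 0 <= \sum_(k < n) a k ^+ 2 by apply: sumr_ge0 => k _; exact: sqr_ge0.
have B0 : 0 <= \sum_(k < n) b k ^+ 2 by apply: sumr_ge0 => k _; exact: sqr_ge0.
have s0 : 0 <= \sum_(k < n) `|a k| * `|b k|.
  by apply: sumr_ge0 => k _; rewrite mulr_ge0.
move: IH A0 B0 s0; move: (\sum_(k < n) a k ^+ 2) (\sum_(k < n) b k ^+ 2) (\sum_(k < n) _).
move=> A B s IH A0 B0 s0.
rewrite -(real_normK (num_real (a n))) -(real_normK (num_real (b n))).
have := normr_ge0 (a n); have := normr_ge0 (b n).
move: `|a n| `|b n| => x y y0 x0.
rewrite sqrrD [leRHS](_ : _ = A * B + (A * y ^+ 2 + B * x ^+ 2) + (x * y) ^+ 2); last by ring.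
rewrite lerD2r lerD// -[leLHS]ger0_norm ?mulrn_wge0 ?mulr_ge0//.
rewrite -ler_sqr ?nnegrE ?addr_ge0 ?mulr_ge0 ?sqr_ge0//.
rewrite ger0_norm ?mulrn_wge0 ?mulr_ge0//.
have : 0 <= (A * y ^+ 2 - B * x ^+ 2) ^+ 2 by exact: sqr_ge0.
have : s ^+ 2 * (x * y) ^+ 2 <= A * B * (x * y) ^+ 2 by rewrite ler_wpM2r ?sqr_ge0.
nra.
Qed.

End CauchySchwarz.

(** * Bases and 1-unconditionality *)

Section BasisCoordinates.
Context {R : realType} (F : normedModType R) (D : set nat) (e : nat -> F).
Hypothesis eD : schauder_basis D e.

Definition basis_coord (x : F) : nat -> R := sval (cid (eD x)).

Lemma basis_coord_on x : coefs_on D (basis_coord x).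
Proof. by rewrite /basis_coord; case: cid => t [[]]. Qed.

Lemma cvg_basis_coord x : series (fun j => basis_coord x j *: e j) @ \oo --> x.
Proof. by rewrite /basis_coord; case: cid => t [[]]. Qed.

Lemma basis_coord_uniq x (t : nat -> R) : coefs_on D t ->
  series (fun j => t j *: e j) @ \oo --> x -> basis_coord x = t.
Proof. by rewrite /basis_coord; case: cid => s [? us] /= Dt tx; exact: us. Qed.

Lemma basis_coordD x y j : basis_coord (x + y) j = basis_coord x j + basis_coord y j.
Proof.
rewrite (@basis_coord_uniq _ (fun j => basis_coord x j + basis_coord y j))//.
  by move=> i Di; rewrite !basis_coord_on// addr0.
rewrite (_ : series _ = series (fun j => basis_coord x j *: e j) \+
                        series (fun j => basis_coord y j *: e j)).
  by apply: cvgD; exact: cvg_basis_coord.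
apply/funext => n; rewrite /series/= -big_split/=.
by apply: eq_bigr => i _; rewrite scalerDl.
Qed.

Lemma basis_coordZ a x j : basis_coord (a *: x) j = a * basis_coord x j.
Proof.
rewrite (@basis_coord_uniq _ (fun j => a * basis_coord x j))//.
  by move=> i Di; rewrite basis_coord_on// mulr0.
rewrite (_ : series _ = a \*: series (fun j => basis_coord x j *: e j)).
  by apply: cvgZr; exact: cvg_basis_coord.
apply/funext => n; rewrite /series/= scaler_sumr.
by apply: eq_bigr => i _; rewrite scalerA.
Qed.

Lemma basis_coordB x y j :
  basis_coord (x - y) j = basis_coord x j - basis_coord y j.
Proof. by rewrite -[- y]scaleN1r basis_coordD basis_coordZ mulN1r. Qed.

Lemma basis_coord_sum n (c : nat -> R) (x : nat -> F) j :
  basis_coord (\sum_(k < n) c k *: x k) j = \sum_(k < n) c k * basis_coord (x k) j.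
Proof.
elim: n => [|n IH]; last by rewrite !big_ord_recr/= basis_coordD basis_coordZ IH.
by rewrite !big_ord0 -(scale0r (0 : F)) basis_coordZ mul0r.
Qed.

Hypothesis eu : unconditional1 D e.

(* A signed partial sum is half the sum of the two full series whose signs
   agree before [J] and are opposite from [J] on. *)
Lemma norm_signed_basis_coord (s : nat -> bool) J x :
  `|\sum_(j < J) (-1) ^+ s j *: (basis_coord x j *: e j)| <= `|x|.
Proof.
pose t c j := if (j < J)%N then s j else c.
pose S c := series (fun j => (-1) ^+ t c j *: (basis_coord x j *: e j)).
have xE : limn (series (fun j => basis_coord x j *: e j)) = x.
  by apply: cvg_lim; [exact: norm_hausdorff|exact: cvg_basis_coord].
have cS c : cvgn (S c) /\ `|limn (S c)| <= `|x|.
  have := eu (t c) (@basis_coord_on x) (cvgP _ (@cvg_basis_coord x)).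
  by rewrite xE.
have SS : limn (S true) + limn (S false) =
    2 *: \sum_(j < J) (-1) ^+ s j *: (basis_coord x j *: e j).
  have cSS : (S true \+ S false) @ \oo --> limn (S true) + limn (S false).
    by apply: cvgD; [case: (cS true)|case: (cS false)].
  rewrite -(cvg_lim (@norm_hausdorff _ F) cSS).
  apply: cvg_lim; first exact: norm_hausdorff.
  apply: cvg_near_cst; near=> n.
  have Jn : (J <= n)%N by near: n; exact: nbhs_infty_ge.
  rewrite /S /series/= -big_split/= (big_cat_nat _ Jn)//=.
  rewrite [X in _ + X = _]big_nat_cond [X in _ + X = _]big1 ?addr0; last first.
    move=> j /andP[/andP[Jj _] _]; rewrite /t ltnNge Jj/= expr1 expr0.
    by rewrite scaleN1r scale1r addNr.
  rewrite big_mkord scaler_sumr; apply: eq_bigr => j _.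
  by rewrite /t ltn_ord scaler_nat mulr2n.
rewrite -(ler_pM2l (ltr0n R 2)) -[X in X * `|\sum__ _| ](@normr_nat R) -normrZ -SS.
have [_ h1] := cS true; have [_ h2] := cS false.
by rewrite (le_trans (ler_normD _ _))// mulr_natl mulr2n lerD.
Unshelve. all: by end_near. Qed.

Lemma basis_coord_pairing_norm (g : {linear F -> R^o}) (B : R) J x : 0 <= B ->
  (forall y, `|g y| <= B * `|y|) ->
  \sum_(j < J) `|basis_coord x j| * `|g (e j)| <= B * `|x|.
Proof.
move=> B0 gB.
pose s j := basis_coord x j * g (e j) < 0.
have -> : \sum_(j < J) `|basis_coord x j| * `|g (e j)| =
    g (\sum_(j < J) (-1) ^+ s j *: (basis_coord x j *: e j)).
  rewrite linear_sum/=; apply: eq_bigr => j _; rewrite !linearZ/= -normrM /s.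
  case: ltP => h; first by rewrite ltr0_norm// expr1 scaleN1r.
  by rewrite ger0_norm// expr0 scale1r.
rewrite (le_trans (ler_norm _))// (le_trans (gB _))// ler_wpM2l//.
exact: norm_signed_basis_coord.
Qed.

Lemma basis_coord_pairing n (z : nat -> F) (g : nat -> {linear F -> R^o})
    (A B : R) J : 0 <= B ->
  (forall s : nat -> bool, `|\sum_(k < n) (-1) ^+ s k *: z k| <= A) ->
  (forall (s : nat -> bool) y, `|\sum_(k < n) (-1) ^+ s k * g k y| <= B * `|y|) ->
  \sum_(k < n) \sum_(j < J) `|basis_coord (z k) j| * `|g k (e j)| <= 4 * (A * B).
Proof.
move=> B0 zA gB; rewrite exchange_big/=.
pose a j k := basis_coord (z k) j; pose b j k := g k (e j) : R.
have step j : \sum_(k < n) `|a j k| * `|b j k| <=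
    4 * sign_avg n (fun s => sign_avg n (fun t =>
          `|signed_sum n (a j) s| * `|signed_sum n (b j) t|)).
  apply: le_trans (sum_normM_le_sqrt n (a j) (b j)) _.
  apply: le_trans (ler_pM _ _ (khintchine n (a j)) (khintchine n (b j))) _ => //.
  set Eb := sign_avg n (fun s => `|signed_sum n (b j) s|).
  have -> : (fun s => sign_avg n (fun t =>
      `|signed_sum n (a j) s| * `|signed_sum n (b j) t|)) =
      (fun s => Eb * `|signed_sum n (a j) s|).
    by apply/funext => s; rewrite sign_avgZ mulrC.
  by rewrite sign_avgZ; move: (sign_avg _ _) Eb => x y; lra.
apply: (@le_trans _ _ (\sum_(j < J) 4 * sign_avg n (fun s => sign_avg n (fun t =>
          `|signed_sum n (a j) s| * `|signed_sum n (b j) t|)))).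
  by apply: ler_sum => j _; exact: step.
pose P (s t : nat -> bool) j :=
  `|signed_sum n (a j) s| * `|signed_sum n (b j) t|.
rewrite -mulr_sumr ler_pM2l//.
rewrite -(sign_avg_sum n J (fun j s => sign_avg n (fun t => P s t j))).
rewrite -[leRHS](sign_avg_cst n); apply: ler_sign_avg => s.
rewrite -(sign_avg_sum n J (fun j t => P s t j)) -[leRHS](sign_avg_cst n); apply: ler_sign_avg => t.
set x := \sum_(k < n) (-1) ^+ s k *: z k.
have gl : linear (fun y : F => (\sum_(k < n) (-1) ^+ t k * g k y : R^o)).
  move=> c y1 y2; rewrite scaler_sumr -big_split/=; apply: eq_bigr => k _.
  by rewrite linearP/= mulrDr; congr (_ + _); rewrite scalerAr.
pose gtm := GRing.isLinear.Build R F R^o _ _ gl.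
pose gt : {linear F -> R^o} := HB.pack (fun y : F => (\sum_(k < n) (-1) ^+ t k * g k y : R^o)) gtm.
have := @basis_coord_pairing_norm gt B J x B0 (gB t).
rewrite (eq_bigr (fun j : 'I_J => P s t j)); last first.
  by move=> j _; rewrite /x (basis_coord_sum n (fun k => (-1) ^+ s k) z).
move=> h; apply: le_trans h _; by rewrite mulrC ler_wpM2r // zA.
Qed.

End BasisCoordinates.

(** * Two-dimensional blocks *)

Lemma cvg_sumr {K : numFieldType} {V : normedModType K} {T I : Type}
    (F : set_system T) {FF : Filter F} (r : seq I) (g : I -> T -> V) (l : I -> V) :
  (forall i, g i @ F --> l i) ->
  (fun t => \sum_(i <- r) g i t) @ F --> \sum_(i <- r) l i.
Proof.
move=> gl; elim: r => [|i r IH].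
  by rewrite big_nil; under eq_fun do rewrite big_nil; exact: cvg_cst.
rewrite big_cons; under eq_fun do rewrite big_cons.
by apply: cvgD => //; exact: gl.
Qed.

Section OperatorNorm.
Context {R : realType} (X Y : normedModType R) (u : {linear X -> Y}).
Hypothesis cu : continuous u.

Lemma opnorm_has_sup : has_sup [set `|u x| | x in [set x : X | `|x| <= 1]].
Proof.
split; first by exists `|u 0|; exists 0 => //=; rewrite normr0.
have /linear_boundedP := continuous_linear_bounded 0 (@cu 0).
move=> /pinfty_ex_gt0[M M0 uM]; exists M => _ [x /= x1 <-].
by rewrite (le_trans (uM x))// ler_piMr// ltW.
Qed.

Lemma opnorm_ge0 : 0 <= opnorm u.
Proof.
apply: (@le_trans _ _ `|u 0|) => //; apply: (sup_upper_bound opnorm_has_sup).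
by exists 0 => //=; rewrite normr0.
Qed.

Lemma le_opnorm x : `|u x| <= opnorm u * `|x|.
Proof.
have [->|x0] := eqVneq x 0; first by rewrite linear0 !normr0 mulr0.
have nx : 0 < `|x| by rewrite normr_gt0.
rewrite -ler_pdivrMr// -[X in X / _]/(`|u x|) mulrC.
rewrite -[X in X * _]gtr0_norm ?invr_gt0// -normrZ -linearZ.
apply: (sup_upper_bound opnorm_has_sup); exists (`|x|^-1 *: x) => //=.
by rewrite normrZ gtr0_norm ?invr_gt0// mulVf ?gt_eqF.
Qed.

End OperatorNorm.

Section BiorthogonalDecomposition.
Context {R : realType} (Y : normedModType R).
Variables (e : 'I_2 -> nat -> Y) (f : 'I_2 -> nat -> {linear Y -> R^o}).
Hypothesis biorth :
  forall i j k l, f i k (e j l) = ((i == j) && (k == l))%:R.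
Hypothesis f_continuous : forall i k, continuous (f i k).

Definition blockproj k (y : Y) : Y := \sum_(i < 2) f i k y *: e i k.

Lemma blockprojE k y :
  blockproj k y = f ord0 k y *: e ord0 k + f ord_max k y *: e ord_max k.
Proof.
rewrite /blockproj big_ord_recl big_ord1.
by rewrite (_ : lift _ _ = ord_max :> 'I_2)//; exact: val_inj.
Qed.

Lemma blockproj_is_linear k : linear (blockproj k).
Proof.
move=> a x y; rewrite /blockproj scaler_sumr -big_split/=.
by apply: eq_bigr => i _; rewrite linearP/= scalerDl scalerA.
Qed.

HB.instance Definition _ k :=
  GRing.isLinear.Build R Y Y _ (blockproj k) (blockproj_is_linear k).

Lemma blockproj_e i k l : blockproj k (e i l) = (k == l)%:R *: e i k.
Proof.
rewrite /blockproj (bigD1 i)//= big1 ?addr0; last first.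
  by move=> j ji; rewrite biorth (negPf ji) scale0r.
by rewrite biorth eqxx.
Qed.

Lemma blockproj_comp k l y :
  blockproj k (blockproj l y) = (k == l)%:R *: blockproj k y.
Proof.
rewrite {2}/blockproj linear_sum/=.
under eq_bigr do rewrite linearZ/= blockproj_e.
have [->|_] := eqVneq k l; last by rewrite scale0r big1// => i _; rewrite scale0r scaler0.
by rewrite scale1r; apply: eq_bigr => i _; rewrite scale1r.
Qed.

Lemma blockproj_continuous k : continuous (blockproj k).
Proof.
move=> y; apply: cvg_sumr => i; apply: cvgZr_tmp; exact: f_continuous.
Qed.


Definition block k : {pred Y} := [pred y | y == blockproj k y].

Lemma block_submod_closed k : submod_closed (block k).
Proof.
split=> [|a x y]; first by rewrite inE linear0.
by rewrite !inE linearP => /eqP{1}-> /eqP{1}->.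
Qed.

HB.instance Definition _ k :=
  GRing.isSubmodClosed.Build R Y (block k) (block_submod_closed k).

Definition initial n : {pred Y} := [pred y | y == \sum_(k < n) blockproj k y].

Lemma initial_submod_closed n : submod_closed (initial n).
Proof.
split=> [|a x y]; first by rewrite inE big1// => k _; rewrite linear0.
rewrite !inE => /eqP{1}-> /eqP{1}->; apply/eqP.
rewrite scaler_sumr -big_split/=; apply: eq_bigr => k _.
by rewrite linearP.
Qed.

HB.instance Definition _ n :=
  GRing.isSubmodClosed.Build R Y (initial n) (initial_submod_closed n).

Lemma has_dim_block k : has_dim (block k) 2.
Proof.
exists (fun i => e i k); split=> [c c0 i|y].
  have := congr1 (f i k) c0; rewrite linear0 linear_sum/= (bigD1 i)//=.
  rewrite big1 => [|j ji]; last first.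
    by rewrite linearZ/= biorth eq_sym (negPf ji)/=; exact: mulr0.
  by rewrite addr0 linearZ/= biorth !eqxx => /= <-; rewrite [RHS]mulr1.
split=> [/eqP yE|[c ->]]; first by exists (fun i => f i k y).
rewrite inE linear_sum; apply/eqP; apply: eq_bigr => i _.
by rewrite linearZ/= blockproj_e eqxx scale1r.
Qed.

Lemma initial_e n i k : (k < n)%N -> e i k \in initial n.
Proof.
move=> kn; rewrite inE (bigD1 (Ordinal kn))//= blockproj_e eqxx scale1r.
rewrite big1 ?addr0// => j jk; rewrite blockproj_e.
by rewrite -(inj_eq val_inj)/= in jk; rewrite (negPf jk) scale0r.
Qed.

Lemma finite_dimensional_initial n : finite_dimensional (initial n).
Proof.
pose g (i : 'I_(n + n)) := match fintype.split i with
  inl k => e ord0 k | inr k => e ord_max k end.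
have gE (c : 'I_(n + n) -> R) : \sum_i c i *: g i =
    \sum_(k < n) c (lshift n k) *: e ord0 k +
    \sum_(k < n) c (rshift n k) *: e ord_max k.
  rewrite big_split_ord/=; congr (_ + _); apply: eq_bigr => k _.
    by rewrite /g -[lshift _ _]/(unsplit (inl _)) unsplitK.
  by rewrite /g -[rshift _ _]/(unsplit (inr _)) unsplitK.
have fs i j (c : 'I_n -> R) (l : 'I_n) :
    f i l (\sum_(k < n) c k *: e j k) = (i == j)%:R * c l.
  rewrite linear_sum/= (bigD1 l)//= big1 => [|k kl]; last first.
    rewrite linearZ/= biorth [(_ == _ :> nat)](_ : _ = false) ?andbF; last first.
      by apply/negbTE; rewrite eq_sym.
    exact: mulr0.
  by rewrite addr0 linearZ/= biorth eqxx andbT; exact: mulrC.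
exists (n + n)%N, g; split=> [c|y].
  rewrite gE => c0 i; rewrite -(fintype.splitK i); case: (fintype.split i) => k /=.
    by have := congr1 (f ord0 k) c0; rewrite linear0 linearD/= !fs mul1r mul0r addr0.
  by have := congr1 (f ord_max k) c0; rewrite linear0 linearD/= !fs mul1r mul0r add0r.
split=> [/eqP ->|[c ->]].
  exists (fun i => match fintype.split i with
    inl k => f ord0 k y | inr k => f ord_max k y end).
  rewrite gE -big_split/=; apply: eq_bigr => k _.
  rewrite -[lshift _ _]/(unsplit (inl _)) -[rshift _ _]/(unsplit (inr _)).
  by rewrite !unsplitK /= blockprojE.
apply: rpred_sum => i _; apply: rpredZ; rewrite /g.
by case: fintype.split => k; exact: initial_e.
Qed.

Hypothesis blockproj_cvg :
  forall y, series (fun k => blockproj k y) @ \oo --> y.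
Hypothesis blockproj_uncond : forall n (s : nat -> bool) y,
  `|\sum_(k < n) (-1) ^+ s k *: blockproj k y| <= `|y|.

Lemma blockproj_sum n (z : nat -> Y) k : (forall k, z k \in block k) ->
  blockproj k (\sum_(l < n) z l) = if (k < n)%N then z k else 0.
Proof.
move=> zb; rewrite linear_sum/=.
have zE (l : 'I_n) : blockproj k (z l) = (k == l)%:R *: z k.
  rewrite [z l](eqP (zb l)) blockproj_comp.
  by case: eqP => [<-|_]; rewrite ?scale0r// -(eqP (zb k)).
rewrite (eq_bigr _ (fun l _ => zE l)); case: ltnP => kn.
  rewrite (bigD1 (Ordinal kn))//= eqxx scale1r big1 ?addr0// => l lk.
  by rewrite -(inj_eq val_inj)/= eq_sym in lk; rewrite (negPf lk) scale0r.
by rewrite big1// => l _; rewrite gtn_eqF ?scale0r// (leq_trans _ kn).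
Qed.

Lemma two_dim_unconditional_decomposition :
  has_2dim_unconditional_decomposition Y.
Proof.
exists (fun k => block k : submodClosed Y); split; first exact: has_dim_block.
split; last first.
  exists 1 => n z s zb; rewrite mul1r.
  rewrite [in leLHS](eq_bigr (fun k : 'I_n =>
      (-1) ^+ s k *: blockproj k (\sum_(l < n) z l))).
    exact: blockproj_uncond.
  by move=> k _; rewrite blockproj_sum// ltn_ord.
split=> [k|y].
  rewrite (_ : [set` _] = (fun y => y - blockproj k y) @^-1` [set 0]); last first.
    apply/seteqP; split=> y /=; rewrite inE => /eqP; last by rewrite subr_eq0.
    by move=> <-; rewrite subrr.
  apply: closed_comp => [y _|]; last first.
    exact/accessible_closed_set1/hausdorff_accessible/norm_hausdorff.
  by apply: cvgB; [exact: cvg_id|exact: blockproj_continuous].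
exists (blockproj^~ y); split.
  by split=> // k; rewrite inE blockproj_comp eqxx scale1r.
move=> z [zb zy]; apply/funext => k.
have : (fun n => blockproj k (series z n)) @ \oo --> blockproj k y.
  by apply: continuous_cvg => //; exact: blockproj_continuous.
move=> /(cvg_lim (@norm_hausdorff _ Y)) <-.
apply: cvg_lim; first exact: norm_hausdorff.
apply: cvg_near_cst; near=> n.
rewrite /series/= big_mkord blockproj_sum// ifT//.
by near: n; exact: nbhs_infty_gt.
Unshelve. all: by end_near. Qed.

End BiorthogonalDecomposition.

(** * Failure of local unconditional structure *)

(* The rank one matrix with rows [a * (p, q)] and [b * (p, q)] has determinant
   [0], so its trace is controlled by its off-diagonal entries and the difference
   of its diagonal entries; the last product is that difference corrected by the
   off-diagonal entries. *)
Lemma rank1_trace_bound {R : realType} (a b p q : R) :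
  `|a * p + b * q| <=
  2 * (`|b| * `|p| + `|a| * `|q| + `|a - b| * `|p + q|).
Proof.
rewrite -!normrM; set X := `|b * p|; set Y := `|a * q|.
set Z := `|(a - b) * (p + q)|.
have [X0 Y0 Z0] : [/\ 0 <= X, 0 <= Y & 0 <= Z] by rewrite !normr_ge0.
have h1 : `|a * p - b * q| <= X + Y + Z.
  rewrite (_ : a * p - b * q = b * p - a * q + (a - b) * (p + q)); last by ring.
  by rewrite (le_trans (ler_normD _ _))// lerD2r (le_trans (ler_normB _ _)).
rewrite -ler_sqr ?nnegrE ?mulr_ge0 ?addr_ge0// real_normK ?num_real//.
have -> : (a * p + b * q) ^+ 2 = (a * p - b * q) ^+ 2 + 4 * ((b * p) * (a * q)).
  by ring.
have h2 : (a * p - b * q) ^+ 2 <= (X + Y + Z) ^+ 2.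
  by rewrite -[leLHS]real_normK ?num_real// ler_sqr ?nnegrE ?addr_ge0.
have h3 : (b * p) * (a * q) <= X * Y by rewrite -normrM ler_norm.
nra.
Qed.

Definition line_bound {R : realType} {Y : normedModType R} n
    (x : nat -> Y) (g : nat -> Y -> R) (A B : R) : Prop :=
  (forall s : nat -> bool, `|\sum_(k < n) (-1) ^+ s k *: x k| <= A) /\
  (forall (s : nat -> bool) y, `|\sum_(k < n) (-1) ^+ s k * g k y| <= B * `|y|).

Section NoLocalUnconditionalStructure.
Context {R : realType} (Y : normedModType R).
Variables (e : 'I_2 -> nat -> Y) (f : 'I_2 -> nat -> {linear Y -> R^o}).
Hypothesis biorth :
  forall i j k l, f i k (e j l) = ((i == j) && (k == l))%:R.
Hypothesis f_continuous : forall i k, continuous (f i k).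

Definition line_bounds n (G : nat -> nat -> nat -> nat) (A B : R) : Prop :=
  forall i j, [/\
   line_bound n (fun k => e ord_max (G k i j)) (fun k => f ord0 (G k i j)) A B,
   line_bound n (fun k => e ord0 (G i k j)) (fun k => f ord_max (G i k j)) A B &
   line_bound n (fun k => e ord0 (G i j k) - e ord_max (G i j k))
     (fun k y => f ord0 (G i j k) y + f ord_max (G i j k) y) A B].

Lemma not_local_unconditional_structure :
  (forall C : R, exists n G (A B : R),
    [/\ 0 <= A, 0 <= B, 24 * (C * (A * B)) < n%:R & line_bounds n G A B]) ->
  ~ local_unconditional_structure Y.
Proof.
move=> lines [C C1 lust].
have [n [G [A [B [A0 B0 nAB GAB]]]]] := lines C.
pose M := (\sum_(a < n) \sum_(b < n) \sum_(c < n) (G a b c).+1)%N.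
have GM a b c : (a < n)%N -> (b < n)%N -> (c < n)%N -> (G a b c < M)%N.
  move=> an bn cn; rewrite /M (bigD1 (Ordinal an))//= (bigD1 (Ordinal bn))//=.
  by rewrite (bigD1 (Ordinal cn))//= -!addnA leq_addr.
have [F [u [w [[D [b [bD bu]]] cu cw wu uwC]]]] :=
  lust (initial e f M) (finite_dimensional_initial biorth M).
pose x i k : linsub (initial e f M) := insubd 0 (e i k).
have xE i k : (k < M)%N -> val (x i k) = e i k.
  by move=> kM; rewrite val_insubd initial_e.
have U0 := opnorm_ge0 cu; have W0 := opnorm_ge0 cw.
pose cf i k j := basis_coord bD (u (x i k)) j.
pose gw i k j : R := f i k (w (b j)).
pose tr k J := \sum_(j < J) (cf ord0 k j * gw ord0 k j +
                             cf ord_max k j * gw ord_max k j).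
(* [w u] is the inclusion, so the traces of the blocks sum to [2]. *)
have tr_cvg k : (k < M)%N -> tr k @ \oo --> (2 : R).
  move=> kM.
  have cvg1 i : (fun J => \sum_(j < J) cf i k j * gw i k j) @ \oo --> (1 : R).
    have : (fun J => f i k (w (series (fun j => cf i k j *: b j) J))) @ \oo -->
           f i k (w (u (x i k))).
      apply: continuous_cvg; first exact: f_continuous.
      by apply: continuous_cvg; [exact: cw|exact: cvg_basis_coord].
    rewrite wu xE// biorth !eqxx/=; apply: cvg_trans.
    apply: near_eq_cvg; near=> J.
    rewrite /series/= big_mkord !linear_sum/=; apply: eq_bigr => j _.
    by rewrite !linearZ.
  have -> : tr k = (fun J => \sum_(j < J) cf ord0 k j * gw ord0 k j) \+
                   (fun J => \sum_(j < J) cf ord_max k j * gw ord_max k j).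
    by apply/funext => J; rewrite /tr big_split.
  by rewrite -[2]/(1 + 1 : R); apply: cvgD.
have [J trJ] : exists J, forall k, (k < M)%N -> 1 <= tr k J.
  suff : \forall J \near \oo, forall k, (k < M)%N -> 1 <= tr k J.
    by move=> [J _ h]; exists J => k kM; apply: h => //=.
  have : forall m, (m <= M)%N ->
      \forall J \near \oo, forall k, (k < m)%N -> 1 <= tr k J.
    elim=> [_|m IH mM]; first exact: nearW.
    have := IH (ltnW mM); apply: filterS2; last first.
      have : (1 : R) < 2 by lra.
      exact: (cvgr_ge _ (tr_cvg _ mM)).
    by move=> J tm h k; rewrite ltnS leq_eqVlt => /predU1P[->//|]; exact: h.
  by apply.
pose X0 k := \sum_(j < J) `|cf ord_max k j| * `|gw ord0 k j|.
pose X1 k := \sum_(j < J) `|cf ord0 k j| * `|gw ord_max k j|.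
pose X2 k := \sum_(j < J) `|cf ord0 k j - cf ord_max k j| *
                          `|gw ord0 k j + gw ord_max k j|.
have XM k : (k < M)%N -> 2^-1 <= X0 k + X1 k + X2 k.
  move=> kM; rewrite -(ler_pM2l (ltr0n R 2)) mulfV//.
  rewrite (le_trans (trJ k kM))// -!big_split mulr_sumr/= ler_sum// => j _.
  by apply: le_trans (rank1_trace_bound _ _ _ _); rewrite ler_norm.
have lineE (y : nat -> Y) (z : nat -> linsub (initial e f M))
    (g : nat -> {linear Y -> R^o}) : (forall k, (k < n)%N -> val (z k) = y k) ->
    line_bound n y (fun k => g k) A B ->
    \sum_(k < n) \sum_(j < J) `|basis_coord bD (u (z k)) j| * `|g k (w (b j))| <=
      4 * (C * (A * B)).
  move=> zy [yA gB].
  apply: (@le_trans _ _ (4 * ((opnorm u * A) * (B * opnorm w)))).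
    pose gk k : {linear F -> R^o} := g k \o w.
    apply: (@basis_coord_pairing _ _ _ _ bD bu n (u \o z) gk) => [|s|s v].
    - exact: mulr_ge0.
    - rewrite (_ : \sum_(k < n) _ = u (\sum_(k < n) (-1) ^+ s k *: z k)).
        rewrite (le_trans (le_opnorm cu _))// ler_wpM2l//.
        rewrite -[leLHS]/(`|val (\sum_(k < n) (-1) ^+ s k *: z k)|).
        rewrite linear_sum/=.
        rewrite (eq_bigr (fun k : 'I_n => (-1) ^+ s k *: y k)) => [|k _].
          exact: yA.
        by rewrite -(zy k)//; exact: linearZ.
      by rewrite linear_sum/=; apply: eq_bigr => k _; rewrite linearZ.
    - rewrite (le_trans (gB s (w v)))// -mulrA ler_wpM2l//; exact: le_opnorm.
  rewrite ler_pM2l// (_ : _ * _ = (opnorm u * opnorm w) * (A * B)); last by ring.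
  by rewrite ler_wpM2r// mulr_ge0.
set T := 4 * (C * (A * B)) in lineE.
have line0 i j : (i < n)%N -> (j < n)%N -> \sum_(k < n) X0 (G k i j) <= T.
  move=> ni nj; have [+ _ _] := GAB i j.
  apply: (lineE _ (fun k => x ord_max (G k i j)) (fun k => f ord0 (G k i j))).
  by move=> k kn; rewrite xE// GM.
have line1 i j : (i < n)%N -> (j < n)%N -> \sum_(k < n) X1 (G i k j) <= T.
  move=> ni nj; have [_ + _] := GAB i j.
  apply: (lineE _ (fun k => x ord0 (G i k j)) (fun k => f ord_max (G i k j))).
  by move=> k kn; rewrite xE// GM.
have line2 i j : (i < n)%N -> (j < n)%N -> \sum_(k < n) X2 (G i j k) <= T.
  move=> ni nj; have [_ _ +] := GAB i j.
  pose xx k := x ord0 (G i j k) - x ord_max (G i j k).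
  pose ff k : {linear Y -> R^o} := f ord0 (G i j k) \+ f ord_max (G i j k).
  have xxE k : (k < n)%N -> val (xx k) = e ord0 (G i j k) - e ord_max (G i j k).
    by move=> kn; rewrite /xx linearB/= !xE// GM.
  move/(lineE _ xx ff xxE); apply: le_trans.
  rewrite le_eqVlt; apply/orP; left; apply/eqP.
  apply: eq_bigr => k _; apply: eq_bigr => l _; congr (`| _ | * _).
  by rewrite /xx linearB/= basis_coordB.
have n0 : 0 < n%:R :> R.
  by apply: le_lt_trans nAB; rewrite !mulr_ge0// (le_trans _ C1).
have sumc (c : R) : n%:R * c = \sum_(i < n) c.
  by rewrite sumr_const card_ord mulr_natl.
have sum3 (g : nat -> nat -> nat -> R) (c : R) :
    (forall i j, (i < n)%N -> (j < n)%N -> \sum_(k < n) g i j k <= c) ->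
    \sum_(i < n) \sum_(j < n) \sum_(k < n) g i j k <= n%:R * (n%:R * c).
  move=> gc; rewrite sumc; apply: ler_sum => i _.
  rewrite sumc; apply: ler_sum => j _; exact: gc.
have : n%:R * (n%:R * (n%:R * 2^-1)) <= 3 * (n%:R * (n%:R * T)) :> R.
  apply: (@le_trans _ _ (\sum_(i < n) \sum_(j < n) \sum_(k < n)
      (X0 (G i j k) + X1 (G i j k) + X2 (G i j k)))).
    rewrite sumc; apply: ler_sum => i _; rewrite sumc; apply: ler_sum => j _.
    rewrite sumc; apply: ler_sum => k _.
    by rewrite XM// GM.
  rewrite [leLHS](_ : _ = \sum_(j < n) \sum_(k < n) \sum_(i < n) X0 (G i j k) +
     \sum_(i < n) \sum_(k < n) \sum_(j < n) X1 (G i j k) +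
     \sum_(i < n) \sum_(j < n) \sum_(k < n) X2 (G i j k)).
    rewrite [leRHS](_ : _ = n%:R * (n%:R * T) + n%:R * (n%:R * T) +
                            n%:R * (n%:R * T)); last by ring.
    apply: lerD; first apply: lerD.
    - by apply: (sum3 (fun j k i => X0 (G i j k))) => *; exact: line0.
    - by apply: (sum3 (fun i k j => X1 (G i j k))) => *; exact: line1.
    - by apply: (sum3 (fun i j k => X2 (G i j k))) => *; exact: line2.
  under eq_bigr => i _.
    under eq_bigr do rewrite !big_split/=.
    rewrite !big_split/=; over.
  rewrite !big_split/=; congr (_ + _ + _).
    rewrite exchange_big/=; apply: eq_bigr => j _; exact: exchange_big.
  by apply: eq_bigr => i _; exact: exchange_big.
rewrite ![3 * _]mulrCA !ler_pM2l// /T; move: nAB; lra.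
Unshelve. all: by end_near. Qed.


End NoLocalUnconditionalStructure.

(** * Sequence spaces *)

Section LspaceRepresentatives.
Context d (T : measurableType d) (R : realType).
Variables (mu : {measure set T -> \bar R}) (p : \bar R) (p1 : (1 <= p)%E).
Local Notation Ls := (LspaceType mu p1).
Implicit Types (x y : Ls).

Lemma norm_LspaceE x : (`|x|%:E = 'N[mu]_p[EFin \o Lrepr x])%E.
Proof. exact: (finite_norm_fine (Lrepr x)). Qed.

Lemma Lrepr_D x y : (Lrepr (x + y) : T -> R) = Lrepr x \+ Lrepr y %[ae mu].
Proof. exact: (Lrepr_class (Lrepr x + Lrepr y)). Qed.

Lemma Lrepr_Z a x : (Lrepr (a *: x) : T -> R) = a \*: (Lrepr x : T -> R^o) %[ae mu].
Proof. exact: (Lrepr_class (a *: Lrepr x)). Qed.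

Lemma norm_Lclass (f : LfunType mu p1) :
  (`|Lclass f|%:E = 'N[mu]_p[EFin \o f])%E.
Proof. by rewrite -finite_norm_fine; congr EFin; exact: Lspace_norm_class. Qed.

End LspaceRepresentatives.

Section CountingSpaces.
Context (R : realType).

Lemma ae_eq_counting (f g : nat -> R) : f = g %[ae @counting nat R] -> f = g.
Proof.
move=> [A [mA A0 fgA]]; apply/funext => i; apply: contrapT => fgi.
have Ai : A i by apply: fgA => /= /(_ I).
move: A0; rewrite /= /counting; case: ifPn => [/asboolP finA|//].
move=> [] /eqP; rewrite pnatr_eq0 finmap.cardfs_eq0 => /eqP/fset_set_set0 A0.
by move: Ai; rewrite A0.
Qed.

Section Exponent.
Variables (p : \bar R) (p1 : (1 <= p)%E).
Local Notation lp := (LspaceType (@counting nat R) p1).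

Lemma seqrepr_inj (x y : lp) : Lrepr x =1 Lrepr y -> x = y.
Proof. by move=> xy; apply: LreprP; apply: nearW => i _; exact: xy. Qed.

Lemma seqreprD (x y : lp) i : Lrepr (x + y) i = Lrepr x i + Lrepr y i.
Proof. by rewrite (ae_eq_counting (Lrepr_D x y)). Qed.

Lemma seqreprZ a (x : lp) i : Lrepr (a *: x) i = a * Lrepr x i.
Proof. by rewrite (ae_eq_counting (Lrepr_Z a x)). Qed.

Lemma seqreprB (x y : lp) i : Lrepr (x - y) i = Lrepr x i - Lrepr y i.
Proof. by rewrite -scaleN1r seqreprD seqreprZ mulN1r. Qed.

End Exponent.

Section RealExponent.
Variables (p : R) (p1 : (1 <= p%:E)%E).
Local Notation lp := (LspaceType (@counting nat R) p1).

Let p0 : 0 < p. Proof. by rewrite (lt_le_trans ltr01). Qed.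

Lemma seqrepr_sum_le (x : lp) n :
  \sum_(i < n) `|Lrepr x i| `^ p <= `|x| `^ p.
Proof.
rewrite -lee_fin -[leRHS]poweR_EFin norm_LspaceE Lnorm_counting// -poweRrM.
rewrite mulVf ?gt_eqF// poweRe1; last first.
  by apply: nneseries_ge0 => i _ _; exact: poweR_ge0.
rewrite -sumEFin -(big_mkord xpredT (fun i => (`|Lrepr x i| `^ p)%:E)).
exact: nneseries_lim_ge.
Qed.

Lemma seqrepr_exists (g : nat -> R) (c : R) : 0 <= c ->
  (forall n, \sum_(i < n) `|g i| `^ p <= c `^ p) ->
  exists x : lp, Lrepr x =1 g /\ `|x| <= c.
Proof.
move=> c0 gc.
have Nc : ('N[counting]_p%:E[EFin \o g] <= c%:E)%E.
  rewrite Lnorm_counting//.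
  rewrite -[c]powRr1// -(mulfV (lt0r_neq0 p0)) powRrM -poweR_EFin.
  rewrite gt0_ler_poweR ?invr_ge0 ?(ltW p0)//.
  - by rewrite in_itv/= leey andbT nneseries_ge0// => i _ _; exact: poweR_ge0.
  - by rewrite in_itv/= leey andbT lee_fin powR_ge0.
  - apply: lime_le; first by apply: is_cvg_nneseries => i _ _; exact: poweR_ge0.
    by apply: nearW => n; rewrite big_mkord; move: (gc n); rewrite -lee_fin -sumEFin.
have gL : g \in Lfun (@counting nat R) p%:E.
  apply/andP; split; first by apply/mem_set.
  by apply/mem_set; exact: le_lt_trans Nc (ltry _).
exists (Lclass (Lfun_Sub p1 gL)); split.
  by move=> i; rewrite (ae_eq_counting (Lrepr_class _)).
by rewrite -lee_fin norm_Lclass.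
Qed.

Lemma seqrepr_le (x : lp) i : `|Lrepr x i| <= `|x|.
Proof.
have := seqrepr_sum_le x i.+1; rewrite big_ord_recr/= => h.
rewrite leNgt; apply/negP => xi.
have := gt0_ltr_powR p0 (normr_ge0 _) (normr_ge0 _) xi.
rewrite ltNge => /negP; apply; apply: le_trans h; rewrite lerDr.
by apply: sumr_ge0 => j _; exact: powR_ge0.
Qed.

End RealExponent.
End CountingSpaces.

Section Ell2.
Context (R : realType).
Local Notation l2 := (ell2 R).

Lemma ell2_sum_le (x : l2) n : \sum_(i < n) Lrepr x i ^+ 2 <= `|x| ^+ 2.
Proof.
have := seqrepr_sum_le x n; rewrite powR_mulrn//.
by under eq_bigr do rewrite powR_mulrn// real_normK ?num_real//.
Qed.

Lemma ell2_exists (g : nat -> R) (c : R) : 0 <= c ->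
  (forall n, \sum_(i < n) g i ^+ 2 <= c ^+ 2) ->
  exists x : l2, Lrepr x =1 g /\ `|x| <= c.
Proof.
move=> c0 gc; apply: seqrepr_exists => // n; rewrite powR_mulrn//.
by under eq_bigr do rewrite powR_mulrn// real_normK ?num_real//.
Qed.

Lemma ell2_abs_summable_cvg (x : nat -> l2) :
  cvgn (series (fun n => `|x n|)) -> cvgn (series x).
Proof.
move=> cx; pose S := limn (series (fun n => `|x n|)).
pose tau N := S - series (fun n => `|x n|) N.
have nd : nondecreasing_seq (series (fun n => `|x n|)).
  by apply/nondecreasing_seqP => n; rewrite /series/= big_nat_recr//= lerDl.
have tail N M : (N <= M)%N -> `|series x M - series x N| <= tau N.
  move=> NM; rewrite sub_series NM; apply: le_trans (ler_norm_sum _ _ _) _.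
  rewrite -[leLHS]/(\sum_(N <= k < M) (fun n => `|x n|) k).
  have := sub_series (fun n => `|x n|) N M; rewrite NM => <-.
  by rewrite lerD2r; exact: nondecreasing_cvgn_le.
have tau0 N : 0 <= tau N by rewrite subr_ge0; exact: nondecreasing_cvgn_le.
have seriesE N i : Lrepr (series x N) i = series (fun n => Lrepr (x n) i) N.
  rewrite /series/=; elim: N => [|N IH].
    rewrite !big_geq//; have := seqreprZ 0 (0 : l2) i.
    by rewrite scale0r mul0r.
  rewrite !big_nat_recr//= -IH. exact: seqreprD.
have cg i : cvgn (series (fun n => Lrepr (x n) i)).
  apply: normed_cvg; apply: (series_le_cvg _ _ _ cx) => n; [exact: normr_ge0|exact: normr_ge0|].
  rewrite /=. exact: (seqrepr_le (x n) i).
pose g i := limn (series (fun n => Lrepr (x n) i)).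
have cgi i : (fun M => Lrepr (series x M) i) @ \oo --> g i.
  rewrite (_ : (fun M => _) = series (fun n => Lrepr (x n) i)); first exact: cg.
  by apply/funext => M; exact: seriesE.
have gS N n : \sum_(i < n) (g i - Lrepr (series x N) i) ^+ 2 <= tau N ^+ 2.
  have lim : (fun M => \sum_(i < n) (Lrepr (series x M) i - Lrepr (series x N) i) ^+ 2)
      @ \oo --> \sum_(i < n) (g i - Lrepr (series x N) i) ^+ 2.
    apply: (@cvg_sumr _ R^o) => i; under eq_fun do rewrite expr2.
    rewrite expr2; apply: cvgM.
      by apply: cvgB; [exact: cgi|exact: cvg_cst].
    by apply: cvgB; [exact: cgi|exact: cvg_cst].
  rewrite -(cvg_lim (@norm_hausdorff _ R^o) lim).
  apply: limr_le; first exact: cvgP lim.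
  near=> M; have NM : (N <= M)%N by near: M; exact: nbhs_infty_ge.
  apply: (@le_trans _ _ (`|series x M - series x N| ^+ 2)); last first.
    by rewrite ler_sqr ?nnegrE ?tail.
  apply: le_trans (ell2_sum_le _ n).
  apply: ler_sum => i _; rewrite le_eqVlt; apply/orP; left; apply/eqP.
  by congr (_ ^+ 2); apply/esym; exact: seqreprB.
have [y [yg _]] : exists y : l2, Lrepr y =1 g /\ `|y| <= tau 0.
  apply: ell2_exists => // n; have := gS 0 n.
  rewrite (eq_bigr (fun i : 'I_n => g i ^+ 2))// => i _.
  by rewrite seriesE /series/= big_geq// subr0.
apply/cvg_ex; exists y; apply/cvgrPdist_le => eps eps0.
have : tau @ \oo --> 0.
  by rewrite -(subrr S); apply: cvgB; [exact: cvg_cst|exact: cx].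
move=> /cvgrPdist_le/(_ _ eps0); apply: filterS => N.
rewrite sub0r normrN ger0_norm//; apply: le_trans.
have [z [zE zt]] := @ell2_exists (fun i => g i - Lrepr (series x N) i) _ (tau0 N) (gS N).
rewrite (_ : y - _ = z)//; apply: seqrepr_inj => i.
by rewrite zE -yg; exact: seqreprB.
Unshelve. all: by end_near. Qed.

End Ell2.

(** * The Gordon-Lewis property *)

(* Coordinates on the span of two vectors that are bounded by the norm: [c]
   minimises [`|A + c *: B|], so that the span of [B] is complemented by that of
   [A + c *: B] with a projection of norm [1]. *)
Lemma plane_coordinates {R : realType} (E : normedModType R) (A B : E) :
  exists (w1 w2 : E) (a b c : R), [/\ `|w1| <= 1, `|w2| <= 1 &
    forall s t, [/\ s *: A + t *: B = (s * a) *: w1 + ((t - s * c) * b) *: w2,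
      `|s * a| <= `|s *: A + t *: B| &
      `|(t - s * c) * b| <= 2 * `|s *: A + t *: B|]].
Proof.
have [c cmin] : exists c : R, forall x, `|A + c *: B| <= `|A + x *: B|.
  have [->|B0] := eqVneq B 0.
    by exists 0 => x; rewrite !scaler0.
  have nB : 0 < `|B| by rewrite normr_gt0.
  pose M := 2 * `|A| / `|B|.
  have M0 : 0 <= M by rewrite divr_ge0// mulr_ge0.
  have cont : continuous (fun x : R => `|A + x *: B|).
    move=> x; apply: (@cvg_norm _ E); apply: cvgD; first exact: cvg_cst.
    by apply: cvgZr_tmp; exact: cvg_id.
  have NM : - M <= M by rewrite ge0_cp.
  have [c _ cm] := EVT_min NM (continuous_subspaceT cont).
  exists c => x; have [xM|xM] := boolP (x \in `[- M, M]); first exact: cm.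
  apply: (@le_trans _ _ `|A|).
    rewrite -[X in _ <= `|X|]addr0 -(scale0r B); apply: cm.
    by rewrite in_itv/= oppr_le0 M0.
  have Mx : M < `|x|.
    rewrite ltNge; apply: contra xM; rewrite in_itv/= => xM.
    by rewrite -ler_norml.
  have : 2 * `|A| <= `|x| * `|B| by rewrite -ler_pdivrMr// ltW.
  rewrite -normrZ => h.
  have := ler_normB (A + x *: B) A; rewrite addrAC subrr add0r.
  by move: h; move: `|_| `|A| `|_ + _| => u v z; lra.
pose A' := A + c *: B.
have unit (x : E) : `| `|x|^-1 *: x | <= 1.
  rewrite normrZ normfV normr_id; have [->|x0] := eqVneq `|x| 0.
    by rewrite mulr0.
  by rewrite mulVf.
have unitE (x : E) : `|x| *: (`|x|^-1 *: x) = x.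
  have [->|x0] := eqVneq x 0; first by rewrite !scaler0.
  by rewrite scalerA mulfV ?scale1r// normr_eq0.
exists (`|A'|^-1 *: A'), (`|B|^-1 *: B), `|A'|, `|B|, c; split=> // s t.
have decomp : s *: A + t *: B = s *: A' + (t - s * c) *: B.
  by rewrite /A' scalerDr scalerA -addrA -scalerDl [s * c + _]addrC subrK.
have sA : `|s * `|A'| | <= `|s *: A + t *: B|.
  have [->|s0] := eqVneq s 0; first by rewrite mul0r normr0.
  rewrite (_ : s *: A + t *: B = s *: (A + (t / s) *: B)); last first.
    by rewrite scalerDr scalerA mulrCA mulfV// mulr1.
  by rewrite normrM normr_id normrZ ler_pM2l ?normr_gt0//; exact: cmin.
split=> //; first by rewrite -!scalerA !unitE.
rewrite normrM normr_id -normrZ.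
rewrite (_ : (t - s * c) *: B = s *: A + t *: B - s *: A'); last first.
  by rewrite decomp [in RHS]addrAC subrr add0r.
rewrite (le_trans (ler_normB _ _))// mulr_natl mulr2n lerD2l.
by move: sA; rewrite normrM normr_id normrZ.
Qed.

Section GordonLewis.
Context {R : realType} (Y : normedModType R).
Variables (e : 'I_2 -> nat -> Y) (f : 'I_2 -> nat -> {linear Y -> R^o}).
Local Notation proj := (blockproj e f).
Hypothesis blockproj_cvg :
  forall y, series (fun k => proj k y) @ \oo --> y.
Hypothesis blockproj_uncond : forall n (s : nat -> bool) y,
  `|\sum_(k < n) (-1) ^+ s k *: proj k y| <= `|y|.

Lemma absolutely_summing_blocks (E : normedModType R) (u : {linear Y -> E}) :
  absolutely_summing u -> exists2 K, 0 <= K &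
    forall n y, \sum_(k < n) `|u (proj k y)| <= K * `|y|.
Proof.
move=> [C uC]; exists `|C| => // n y.
apply: le_trans (uC n (fun k => proj k y)) _.
apply: le_trans (ler_norm _) _; rewrite normrM ler_wpM2l//.
rewrite /weak_l1_norm; set W := [set r | _].
have Wy : ubound W `|y|.
  move=> _ [g gle ->].
  pose s k := g (proj k y) < 0.
  have -> : \sum_(k < n) `|g (proj k y)| =
      g (\sum_(k < n) (-1) ^+ s k *: proj k y).
    rewrite linear_sum/=; apply: eq_bigr => k _; rewrite linearZ/= /s.
    case: ltP => h; first by rewrite ltr0_norm// expr1 scaleN1r.
    by rewrite ger0_norm// expr0 scale1r.
  apply: le_trans (ler_norm _) _; apply: le_trans (gle _) _.
  exact: blockproj_uncond.
have W0 : W 0.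
  exists (\0 : {linear Y -> R^o}) => [z|]; first by rewrite normr0.
  by rewrite big1// => k _; rewrite normr0.
rewrite ger0_norm; first by apply: ge_sup => //; exists 0.
by apply: sup_upper_bound => //; split; [exists 0|exists `|y|].
Qed.

Lemma series_pairs (V : zmodType) (F : nat -> V) N :
  series F N.*2 = series (fun k => F k.*2 + F k.*2.+1) N.
Proof.
rewrite /series/=; elim: N => [|N IH]; first by rewrite !big_geq.
by rewrite doubleS !big_nat_recr//= IH addrA.
Qed.

Lemma gordon_lewis_of_blocks : gordon_lewis Y.
Proof.
move=> u cu /absolutely_summing_blocks[K K0 uK].
have /choice[W WP] : forall k, exists W : (ell2 R * ell2 R) * (R * R * R),
    [/\ `|W.1.1| <= 1, `|W.1.2| <= 1 & forall s t,
      [/\ s *: u (e ord0 k) + t *: u (e ord_max k) =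
           (s * W.2.1.1) *: W.1.1 + ((t - s * W.2.2) * W.2.1.2) *: W.1.2,
      `|s * W.2.1.1| <= `|s *: u (e ord0 k) + t *: u (e ord_max k)| &
      `|(t - s * W.2.2) * W.2.1.2| <=
        2 * `|s *: u (e ord0 k) + t *: u (e ord_max k)|]].
  move=> k; have [w1 [w2 [a [b [c wP]]]]] :=
    plane_coordinates (u (e ord0 k)) (u (e ord_max k)).
  by exists ((w1, w2), (a, b, c)).
pose w n : ell2 R := if odd n then (W n./2).1.2 else (W n./2).1.1.
pose g n (y : Y) : R := if odd n
  then (f ord_max n./2 y - f ord0 n./2 y * (W n./2).2.2) * (W n./2).2.1.2
  else f ord0 n./2 y * (W n./2).2.1.1.
have w1 n : `|w n| <= 1 by rewrite /w; have [? ? _] := WP n./2; case: ifP.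
have odd_double1 k : odd k.*2.+1 by rewrite /= odd_double.
have half_double1 k : k.*2.+1./2 = k by rewrite -[_.+1]/(true + k.*2)%N half_bit_double.
have uE k y : u (proj k y) =
    g k.*2 y *: w k.*2 + g k.*2.+1 y *: w k.*2.+1.
  rewrite blockprojE linearD !linearZ/= /g /w odd_double1 odd_double half_double1 doubleK.
  by have [_ _ /(_ (f ord0 k y) (f ord_max k y))[-> _ _]] := WP k.
have gle k y : `|g k.*2 y| + `|g k.*2.+1 y| <= 3 * `|u (proj k y)|.
  rewrite blockprojE linearD !linearZ/= /g odd_double1 odd_double half_double1 doubleK.
  have [_ _ /(_ (f ord0 k y) (f ord_max k y))[_]] := WP k.
  by move: `|_| `|_ * _| `|_ + _| => *; lra.
have gsum n y : \sum_(k < n) `|g k y| <= 3 * K * `|y|.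
  apply: (@le_trans _ _ (series (fun k => `|g k y|) n.*2)).
    rewrite -(big_mkord xpredT (fun k => `|g k y|)).
    apply: nondecreasing_series => //; rewrite -addnn; exact: leq_addr.
  rewrite series_pairs /series/= big_mkord -mulrA.
  apply: le_trans (ler_wpM2l _ (uK n y)) => //.
  by rewrite mulr_sumr; apply: ler_sum => k _; exact: gle.
pose L1 := LspaceType1 (@counting nat R).
have /choice[a aP] : forall y, exists x : L1,
    Lrepr x =1 g^~ y /\ `|x| <= 3 * K * `|y|.
  move=> y; apply: seqrepr_exists => [|n]; first by rewrite !mulr_ge0.
  rewrite powRr1 ?mulr_ge0//.
  by under eq_bigr do rewrite powRr1//.
have g_lin n c y z : g n (c *: y + z) = c * g n y + g n z.
  have sc (x t : R) : x *: (t : R^o) = x * t by [].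
  by rewrite /g !linearP/= !sc; case: ifP => _; ring.
have a_lin : linear a.
  move=> c y z; apply: seqrepr_inj => n; rewrite (aP _).1 g_lin.
  by rewrite seqreprD seqreprZ !(aP _).1.
pose al : {linear Y -> L1} := HB.pack a (GRing.isLinear.Build R Y L1 _ a a_lin).
have xsum (x : L1) n : \sum_(k < n) `|Lrepr x k| <= `|x|.
  have := seqrepr_sum_le x n; rewrite powRr1//.
  by under eq_bigr do rewrite powRr1//.
have xw (x : L1) k : `|Lrepr x k *: w k| <= `|Lrepr x k|.
  by rewrite normrZ ler_piMr.
have cvgx (x : L1) : cvgn (series (fun k => Lrepr x k *: w k)).
  apply: ell2_abs_summable_cvg.
  apply: nondecreasing_is_cvgn.
    by apply/nondecreasing_seqP => n; rewrite /series/= big_nat_recr//= lerDl.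
  exists `|x| => _ [n _ <-]; apply: le_trans (xsum x n).
  by rewrite /series/= big_mkord; apply: ler_sum => k _; exact: xw.
pose b (x : L1) : ell2 R := limn (series (fun k => Lrepr x k *: w k)).
have b_lin : linear b.
  move=> c x y; apply: cvg_lim; first exact: norm_hausdorff.
  rewrite (_ : series _ = (c \*: series (fun k => Lrepr x k *: w k)) \+
                          series (fun k => Lrepr y k *: w k)).
    by apply: cvgD; [apply: cvgZl_tmp|]; exact: cvgx.
  apply/funext => n; rewrite /series/= scaler_sumr -big_split/=.
  apply: eq_bigr => k _; rewrite scalerA -scalerDl; congr (_ *: _).
  by rewrite -[c * _](seqreprZ c x); exact: (seqreprD (c *: x) y).
pose bl : {linear L1 -> ell2 R} :=
  HB.pack b (GRing.isLinear.Build R L1 (ell2 R) _ b b_lin).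
exists _, nat, (@counting nat R), al, bl; split.
- apply/linear_bounded_continuous/linear_boundedP; near=> r => y.
  rewrite (le_trans (aP y).2)// ler_wpM2r//; near: r; exact: nbhs_pinfty_ge.
- apply/linear_bounded_continuous/linear_boundedP; near=> r => x.
  apply: (@le_trans _ _ (1 * `|x|)); last first.
    by rewrite ler_wpM2r//; near: r; exact: nbhs_pinfty_ge.
  rewrite mul1r /= /b.
  have h : (fun n => `|series (fun k => Lrepr x k *: w k) n|) @ \oo -->
      `|limn (series (fun k => Lrepr x k *: w k))|.
    by apply: cvg_norm; exact: cvgx.
  rewrite -(cvg_lim (@norm_hausdorff _ R^o) h); apply: limr_le; first exact: cvgP h.
  apply: nearW => n; apply: le_trans (xsum x n).
  rewrite /series/= big_mkord; apply: le_trans (ler_norm_sum _ _ _) _.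
  by apply: ler_sum => k _; exact: xw.
move=> y /=.
have lim1 : (fun N => u (series (fun k => proj k y) N)) @ \oo --> u y.
  by apply: continuous_cvg => //; exact: cu.
have lim2 : (fun N => series (fun k => Lrepr (a y) k *: w k) N.*2) @ \oo --> b (a y).
  suff dbl : double @ \oo --> \oo.
    apply: (@cvg_comp _ _ _ double (series (fun k => Lrepr (a y) k *: w k)) _ _ _ dbl).
    exact: cvgx.
  apply/cvgnyPge => m; near=> N; rewrite -addnn.
  apply: (@leq_trans N); last exact: leq_addr.
  by near: N; exact: nbhs_infty_ge.
have E N : u (series (fun k => proj k y) N) =
  series (fun k => Lrepr (a y) k *: w k) N.*2.
  rewrite series_pairs /series/= linear_sum/=; apply: eq_bigr => k _.
  rewrite uE; congr (_ *: _ + _ *: _); exact/esym/(aP y).1.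
rewrite -(cvg_lim (@norm_hausdorff _ (ell2 R)) lim1).
apply: cvg_lim; first exact: norm_hausdorff.
by rewrite (funext E).
Unshelve. all: by end_near. Qed.

End GordonLewis.

(** * Dyadic digits *)

Section DyadicDigits.
Context {R : realType}.
Implicit Types (x : R) (d j v : nat).

Definition dyad d x : nat := Num.truncn (2 ^+ d * x).

Definition dyadic_sign d x : R := (-1) ^+ odd (dyad d x).

Definition flip d x : R :=
  if 0 <= x < 1 then
    if odd (dyad d x) then x - (2 ^+ d)^-1 else x + (2 ^+ d)^-1
  else x.

Lemma dyad_itv d x : 0 <= x ->
  (dyad d x)%:R <= 2 ^+ d * x < (dyad d x).+1%:R.
Proof. by move=> x0; apply: truncn_itv; rewrite mulr_ge0// exprn_ge0. Qed.

Lemma dyad_eq d x n : n%:R <= 2 ^+ d * x < n.+1%:R -> dyad d x = n.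
Proof. exact: truncn_def. Qed.

Lemma dyad_half d x : 0 <= x -> dyad d x = (dyad d.+1 x)./2.
Proof.
move=> x0; apply: dyad_eq; have := dyad_itv d.+1 x0; rewrite exprS.
set n := dyad _ _.
have nE : n%:R = (odd n)%:R + 2 * (n./2)%:R :> R.
  by rewrite -{1}(odd_double_half n) natrD -mul2n natrM.
have b01 (b : bool) : 0 <= (b%:R : R) <= 1 by case: b; rewrite ler0n ?lexx ?ler01.
have := b01 (odd n); rewrite -!natr1 nE -mulrA.
by move: (odd n)%:R (n./2)%:R (2 ^+ d * x) => a b c; lra.
Qed.

Lemma dyad_lt d x : 0 <= x < 1 -> (dyad d x < 2 ^ d)%N.
Proof.
move=> /andP[x0 x1]; rewrite -(ltr_nat R) natrX.
have /andP[le_x _] := dyad_itv d x0; apply: le_lt_trans le_x _.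
by rewrite gtr_pMr// exprn_gt0.
Qed.

Section Flip.
Variables (d : nat) (x : R).
Hypotheses (d0 : (0 < d)%N) (x01 : 0 <= x < 1).

Let pow_unit : 2 ^+ d * (2 ^+ d)^-1 = 1 :> R.
Proof. by rewrite mulfV// expf_neq0. Qed.

Lemma flip_scaled : 2 ^+ d * flip d x =
  if odd (dyad d x) then 2 ^+ d * x - 1 else 2 ^+ d * x + 1.
Proof. by rewrite /flip x01; case: ifP => _; rewrite ?mulrBr ?mulrDr pow_unit. Qed.

Lemma flip_itv : 0 <= flip d x < 1.
Proof.
have x0 : 0 <= x by case/andP: x01.
have p0 : 0 < 2 ^+ d :> R by rewrite exprn_gt0.
suff /andP[h1 h2] : 0 <= 2 ^+ d * flip d x < 2 ^+ d.
  by rewrite -(pmulr_rge0 _ p0) h1 /= -(ltr_pM2l p0) mulr1.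
have := dyad_lt d x01; have := dyad_itv d x0; rewrite flip_scaled.
have oddp : odd (2 ^ d) = false by rewrite oddX; case: (d) d0.
case: ifPn => odd_n /andP[h1 h2] lt_n.
  have n1 : (1 : R) <= (dyad d x)%:R by rewrite ler1n odd_gt0.
  have : (dyad d x).+1%:R <= 2 ^+ d :> R by rewrite -natrX ler_nat.
  by move: h1 h2 n1; lra.
have : (dyad d x).+2%:R <= 2 ^+ d :> R.
  rewrite -natrX ler_nat ltn_neqAle lt_n andbT; apply/eqP => e.
  by move: oddp; rewrite -e /= (negbTE odd_n).
have : (0 : R) <= (dyad d x)%:R by [].
by move: h1 h2; rewrite -!natr1; lra.
Qed.

Lemma dyad_flip : dyad d (flip d x) =
  if odd (dyad d x) then (dyad d x).-1 else (dyad d x).+1.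
Proof.
have x0 : 0 <= x by case/andP: x01.
apply: dyad_eq; rewrite flip_scaled; have := dyad_itv d x0.
case: ifP => [/odd_gt0|_]; last by rewrite -!natr1; lra.
by case: (dyad d x) => // n _; rewrite /= -!natr1; lra.
Qed.

Lemma dyad_flip_low j : (j < d)%N -> dyad j (flip d x) = dyad j x.
Proof.
have x0 : 0 <= x by case/andP: x01.
have f0 : 0 <= flip d x by case/andP: flip_itv.
move=> jd; have : (d - j.+1 + j.+1 = d)%N by rewrite subnK.
move: (d - j.+1)%N => m; elim: m j {jd} => [|m IH] j dE.
  rewrite add0n in dE.
  rewrite dyad_half// [RHS]dyad_half// dE dyad_flip.
  by case: ifP => odd_n; lia.
by rewrite dyad_half// [RHS]dyad_half// IH// -addSnnS.
Qed.

Lemma odd_dyad_flip_high j : (d < j)%N ->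
  odd (dyad j (flip d x)) = odd (dyad j x).
Proof.
have x0 : 0 <= x by case/andP: x01.
have f0 : 0 <= flip d x by case/andP: flip_itv.
move=> dj; have [m jE] : exists m, j = (m.+1 + d)%N.
  by exists (j - d).-1; lia.
have scaled : 2 ^+ j * flip d x =
  if odd (dyad d x) then 2 ^+ j * x - (2 ^ m.+1)%:R else 2 ^+ j * x + (2 ^ m.+1)%:R.
  rewrite jE exprD -mulrA flip_scaled natrX.
  by case: ifP => _; ring.
have := dyad_itv j x0; have : odd (2 ^ m.+1) = false by rewrite oddX.
move: scaled; case: ifP => _ scaled oddm h; last first.
  rewrite (@dyad_eq j (flip d x) (dyad j x + 2 ^ m.+1)%N).
    by rewrite oddD oddm addbF.
  by rewrite scaled -addSn !natrD lerD2r ltrD2r.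
have mle : (2 ^ m.+1 <= dyad j x)%N.
  rewrite -ltnS -(ltr_nat R).
  have : 0 <= 2 ^+ j * flip d x by rewrite mulr_ge0// exprn_ge0.
  by rewrite scaled subr_ge0 => /le_lt_trans; apply; case/andP: h.
rewrite (@dyad_eq j (flip d x) (dyad j x - 2 ^ m.+1)%N).
  by rewrite oddB// oddm addbF.
by rewrite scaled -subSn// !natrB// ?(leqW mle)// lerD2r ltrD2r.
Qed.

Lemma flipK : flip d (flip d x) = x.
Proof.
have p0 : 2 ^+ d != 0 :> R by rewrite expf_neq0.
apply: (mulfI p0); rewrite {1}/flip flip_itv dyad_flip.
case: (boolP (odd (dyad d x))) => [/[dup] /odd_gt0|] => [n0|] odd_n.
  have -> : odd (dyad d x).-1 = false by lia.
  by rewrite mulrDr flip_scaled odd_n pow_unit subrK.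
by rewrite /= odd_n mulrBr flip_scaled (negbTE odd_n) pow_unit addrK.
Qed.

Lemma dyadic_sign_flip j :
  dyadic_sign j (flip d x) = (-1) ^+ (j == d) * dyadic_sign j x.
Proof.
rewrite /dyadic_sign; case: (ltngtP j d) => [jd|jd|->].
- by rewrite dyad_flip_low// expr0 mul1r.
- by rewrite odd_dyad_flip_high// expr0 mul1r.
rewrite dyad_flip expr1 mulN1r.
case: ifPn => [/[dup]/odd_gt0|] => [n0|] odd_n.
  have -> : odd (dyad d x).-1 = false by lia.
  by rewrite expr1 opprK expr0.
by rewrite /= odd_n expr0 expr1.
Qed.

End Flip.

Definition cell v : set R := [set x | 2 ^- v.+1 <= x < 2 ^- v].

Lemma cell_unit v x : cell v x -> 0 <= x < 1.
Proof.
move=> /andP[h1 h2]; apply/andP; split.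
  by apply: le_trans h1; rewrite invr_ge0 exprn_ge0.
apply: lt_le_trans h2 _; rewrite invf_le1 ?exprn_gt0// exprn_ege1//; lra.
Qed.

Lemma cellE v x : 0 <= x -> cell v x <-> dyad v.+1 x = 1%N.
Proof.
move=> x0; have p0 : 0 < 2 ^+ v.+1 :> R by rewrite exprn_gt0.
have -> : cell v x <-> 1%:R <= 2 ^+ v.+1 * x < 2%:R.
  rewrite /cell/= -(ler_pM2l p0) -(ltr_pM2l p0) mulfV ?gt_eqF//.
  by rewrite exprSr -[2 ^+ v * 2 / _]mulrAC mulfV ?mul1r ?expf_neq0.
split; first exact: dyad_eq.
by have := dyad_itv v.+1 x0 => /[swap] ->.
Qed.

Lemma cell_flip d v x : (v.+1 < d)%N -> 0 <= x < 1 ->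
  cell v (flip d x) <-> cell v x.
Proof.
move=> vd x01; have d0 : (0 < d)%N by exact: leq_ltn_trans vd.
have /andP[x0 _] := x01; have /andP[f0 _] := flip_itv d0 x01.
by rewrite !cellE// dyad_flip_low.
Qed.

Lemma cell_disj v v' x : cell v x -> cell v' x -> v = v'.
Proof.
wlog vv : v v' / (v <= v')%N.
  move=> H; have [/H//|/ltnW vv h1 h2] := leqP v v'.
  by apply/esym; apply: H h2 h1.
move=> /andP[h1 _] /andP[_ h2]; have := le_lt_trans h1 h2.
rewrite ltf_pV2 ?posrE ?exprn_gt0// ltr_eXn2l ?ltr1n// ltnS => v'v.
by apply/eqP; rewrite eqn_leq vv.
Qed.

(* Flipping a digit moves the cells beyond it; [tail_flip] leaves them alone. *)
Definition tail_flip d x : R := if x < 2 ^- d.-1 then x else flip d x.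

Lemma flip_lt d x : (0 < d)%N -> (flip d x < 2 ^- d.-1) = (x < 2 ^- d.-1).
Proof.
move=> d0; have p0 : 0 < 2 ^+ d.-1 :> R by rewrite exprn_gt0.
have [x01|x01] := boolP (0 <= x < 1); last by rewrite /flip (negbTE x01).
have /andP[x0 _] := x01; have /andP[f0 _] := flip_itv d0 x01.
have lt_dyad (y : R) : 0 <= y -> (y < 2 ^- d.-1) = (dyad d.-1 y == 0%N).
  move=> y0; have -> : (dyad d.-1 y == 0%N) = (dyad d.-1 y <= 0)%N by rewrite leqn0.
  by rewrite truncn_le_nat -(ltr_pM2l p0) mulfV ?gt_eqF.
by rewrite !lt_dyad// dyad_flip_low// prednK.
Qed.

End DyadicDigits.

(** * Flipping digits preserves measure *)

Section FlipInvariance.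
Context {R : realType}.
Local Notation T := (measurableTypeR R).
Local Notation mu := (lebesgue01 R).
Local Notation leb := (@lebesgue_measure R).

Lemma measurable_shift (h : R) : measurable_fun [set: T] (fun x : T => x + h : T).
Proof. by apply: measurable_funD. Qed.

Lemma lebesgue_measure_shift (h : R) (A : set T) : measurable A ->
  leb ((fun x : R => x + h) @^-1` A) = leb A.
Proof.
move=> mA; pose nu := measure_function_pushforward__canonical__measure_function_Measure
  leb (@measurable_shift h).
apply/esym; apply: (@lebesgue_measure_unique R nu _ A mA) => _ [[a b] _ <-] /=.
rewrite /pushforward (_ : _ @^-1` _ = `]a - h, b - h]%classic).
  rewrite !lebesgue_measure_itv /= !lte_fin ltrD2r.
  by case: ifP => // _; rewrite -!EFinB opprB addrA subrK.
by apply/seteqP; split=> x /=; rewrite !in_itv/= ltrBlDr lerBrDr.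
Qed.

Lemma measurable_cell v : measurable (cell v : set T).
Proof. by rewrite /cell -set_itvco; exact: measurable_itv. Qed.

Lemma measurable_odd_dyad d : measurable ([set x | odd (dyad d x)] : set T).
Proof.
rewrite [X in measurable X](_ : _ = \bigcup_n
    `[n.*2.+1%:R / 2 ^+ d, n.*2.+2%:R / 2 ^+ d[%classic).
  by apply: bigcup_measurable => n _; exact: measurable_itv.
have p0 : 0 < 2 ^+ d :> R by rewrite exprn_gt0.
apply/seteqP; split=> x /=.
  move=> odd_x; have x0 : 0 <= x.
    rewrite leNgt; apply/negP => x0; move: odd_x.
    suff -> : dyad d x = 0%N by [].
    apply/eqP; rewrite -leqn0 truncn_le_nat.
    by apply: lt_le_trans ler01; rewrite pmulr_rlt0.
  exists (dyad d x)./2 => //=; rewrite in_itv/= ler_pdivrMr// ltr_pdivlMr// [x * _]mulrC.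
  have := dyad_itv d x0; set n := dyad d x.
  by have -> : (n./2).*2.+1 = n by rewrite -[in RHS](odd_double_half n) odd_x.
case=> n _ /=; rewrite in_itv/= ler_pdivrMr// ltr_pdivlMr// [x * _]mulrC => h.
by rewrite (dyad_eq h) /= odd_double.
Qed.

Lemma measurable_dyadic_sign d : measurable_fun [set: T] (dyadic_sign d : T -> R).
Proof.
rewrite (_ : dyadic_sign d = fun x => if odd (dyad d x) then -1 else 1); last first.
  by apply/funext => x; rewrite /dyadic_sign; case: odd.
apply: measurable_fun_ifT => //; apply: (measurable_fun_bool true).
by rewrite setTI; exact: measurable_odd_dyad.
Qed.

Lemma measurable_flip d : measurable_fun [set: T] (flip d : T -> T).
Proof.
apply: measurable_fun_ifT => //.
  apply: (measurable_fun_bool true); rewrite setTI.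
  rewrite (_ : _ @^-1` _ = `[0, 1[%classic :> set R); first exact: measurable_itv.
  by rewrite set_itvco; apply/seteqP; split.
apply: measurable_fun_ifT.
- apply: (measurable_fun_bool true); rewrite setTI; exact: measurable_odd_dyad.
- exact: measurable_shift.
- exact: measurable_shift.
Qed.

Lemma lebesgue01E (A : set T) : measurable A -> mu A = leb (A `&` `[0, 1[%classic).
Proof.
move=> mA; rewrite /lebesgue01 /mrestr.
transitivity (leb ((A `&` `[0, 1[%classic) `|` (A `&` [set 1]))).
  congr (leb _); rewrite -setIUr; congr (_ `&` _); apply/seteqP; split=> x /=; rewrite !in_itv/=.
    by move=> /andP[-> /=]; rewrite le_eqVlt => /predU1P[->|->]; [right|left].
  by case=> [/andP[-> /ltW->]//|->]; rewrite ler01 lexx.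
apply: measureU0.
- by apply: measurableI => //; exact: measurable_itv.
- by apply: measurableI => //; exact: measurable_set1.
- have m1 : measurable ([set 1] : set T) := measurable_set1 1.
  by apply: (subset_measure0 (measurableI _ _ mA m1) m1 (@subIsetr _ _ _));
    exact: lebesgue_measure_set1.
Qed.

Lemma flip_measure d (A : set T) : (0 < d)%N -> measurable A ->
  mu (flip d @^-1` A) = mu A.
Proof.
move=> d0 mA; set O : set T := [set x | odd (dyad d x)].
set I : set T := `[0, 1[%classic.
have IE x : I x <-> 0 <= x < 1 by rewrite /I /= in_itv.
have mO : measurable O := measurable_odd_dyad d.
have mI : measurable I by exact: measurable_itv.
have mf : measurable (flip d @^-1` A).
  by rewrite -[X in measurable X]setTI; exact: measurable_flip.
rewrite !lebesgue01E//; set h := (2 ^+ d)^-1 : R.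
have flip_odd x : I x -> O x -> flip d x = x - h.
  by move=> /IE x01 Ox; rewrite /flip x01 ifT.
have flip_even x : I x -> ~ O x -> flip d x = x + h.
  by move=> /IE x01 /negP/negbTE Ox; rewrite /flip x01 Ox.
have flipI x : I x -> I (flip d x) by move=> /IE x01; apply/IE; exact: flip_itv.
have flip_swap x : I x -> O (flip d x) <-> ~ O x.
  move=> /IE x01; rewrite /O /= dyad_flip//; case: ifPn => [/[dup]/odd_gt0|] => [n0|] odd_x.
    split; last by move/(_ isT).
    by have -> : odd (dyad d x).-1 = false by lia.
  by rewrite /= odd_x; split.
pose P := (fun x : R => x + h) @^-1` (A `&` I `&` O).
pose Q := (fun x : R => x + - h) @^-1` (A `&` I `\` O).
have -> : flip d @^-1` A `&` I = P `|` Q.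
  apply/seteqP; split=> x /=.
    move=> [Ax Ix]; have [Ox|Ox] := pselect (O x).
      right; rewrite /Q/= -(flip_odd _ Ix Ox); split; first by split=> //; exact: flipI.
      by move=> /(flip_swap _ Ix).
    left; rewrite /P/= -(flip_even _ Ix Ox); split; first by split=> //; exact: flipI.
    exact/flip_swap.
  case=> [[[Ay Iy] Oy]|[[Ay Iy] Oy]].
    have xE : x = flip d (x + h) by rewrite flip_odd// addrK.
    by split; [rewrite /= [in flip d x]xE flipK//; exact/IE|rewrite xE; exact: flipI].
  have xE : x = flip d (x + - h) by rewrite flip_even// subrK.
  by split; [rewrite /= [in flip d x]xE flipK//; exact/IE|rewrite xE; exact: flipI].
have mAI : measurable (A `&` I) by exact: measurableI.
have mAIO : measurable (A `&` I `&` O) by exact: measurableI.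
have mAID : measurable (A `&` I `\` O) by exact: measurableD.
rewrite measureU; first last.
- apply/seteqP; split=> // x [[[Ay Iy] Oy] [[Az Iz] Oz]].
  have xE : x = flip d (x + h) by rewrite flip_odd// addrK.
  have xE' : x = flip d (x + - h) by rewrite flip_even// subrK.
  have : O x by rewrite xE'; exact/flip_swap.
  by rewrite {1}xE => /(flip_swap _ Iy).
- by rewrite -[X in measurable X]setTI; exact: (measurable_shift (- h)).
- by rewrite -[X in measurable X]setTI; exact: (measurable_shift h).
rewrite [RHS](measureDI leb mAI mO) [RHS]addeC; congr (_ + _)%E.
  exact: lebesgue_measure_shift.
exact: lebesgue_measure_shift.
Qed.

Lemma measurable_tail_flip d : measurable_fun [set: T] (tail_flip d : T -> T).
Proof.
apply: measurable_fun_ifT => //; last exact: measurable_flip.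
apply: (measurable_fun_bool true); rewrite setTI.
rewrite (_ : _ @^-1` _ = `]-oo, 2 ^- d.-1[%classic :> set R).
  exact: measurable_itv.
by rewrite set_itvNyo; apply/seteqP; split.
Qed.

Lemma tail_flip_measure d (A : set T) : (0 < d)%N -> measurable A ->
  mu (tail_flip d @^-1` A) = mu A.
Proof.
move=> d0 mA; set L : set T := `]-oo, 2 ^- d.-1[%classic.
have LE x : L x <-> x < 2 ^- d.-1 by rewrite /L /= in_itv.
have mL : measurable L by exact: measurable_itv.
have mAL : measurable (A `\` L) by exact: measurableD.
have mf : measurable (tail_flip d @^-1` A).
  by rewrite -[X in measurable X]setTI; exact: measurable_tail_flip.
rewrite (measureDI mu mf mL) [RHS](measureDI mu mA mL); congr (_ + _)%E.
  transitivity (mu (flip d @^-1` (A `\` L))); last exact: flip_measure.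
  congr (mu _); apply/seteqP; split=> x /=.
    move=> [Ax /LE Lx]; move: Ax; rewrite /tail_flip; case: ifP => // _ Ax.
    by split=> // /LE; rewrite flip_lt.
  move=> [Ax /LE]; rewrite flip_lt// => Lx; split; last by move=> /LE.
  by rewrite /tail_flip; case: ifP.
congr (mu _); apply/seteqP; split=> x /= [Ax /LE Lx]; split; try exact/LE.
  by move: Ax; rewrite /tail_flip Lx.
by rewrite /tail_flip Lx.
Qed.

Lemma ge0_integral_tail_flip d (g : T -> \bar R) : (0 < d)%N ->
  measurable_fun [set: T] g -> (forall x, 0 <= g x)%E ->
  (\int[mu]_x g (tail_flip d x) = \int[mu]_x g x)%E.
Proof.
move=> d0 mg g0.
pose nu := measure_function_pushforward__canonical__measure_function_Measure
  mu (@measurable_tail_flip d).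
have -> : (\int[mu]_x g x = \int[nu]_x g x)%E.
  by apply: eq_measure_integral => A mA _; apply/esym; exact: tail_flip_measure.
by rewrite (@ge0_integral_pushforward _ _ _ _ _ _ (@measurable_tail_flip d) mu setT g).
Qed.

Lemma ge0_integral_flip d (g : T -> \bar R) : (0 < d)%N ->
  measurable_fun [set: T] g -> (forall x, 0 <= g x)%E ->
  (\int[mu]_x g (flip d x) = \int[mu]_x g x)%E.
Proof.
move=> d0 mg g0.
pose nu := measure_function_pushforward__canonical__measure_function_Measure
  mu (@measurable_flip d).
have -> : (\int[mu]_x g x = \int[nu]_x g x)%E.
  by apply: eq_measure_integral => A mA _; apply/esym; exact: flip_measure.
by rewrite (@ge0_integral_pushforward _ _ _ _ _ _ (@measurable_flip d) mu setT g).
Qed.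

Lemma integral_flip d (g : T -> \bar R) : (0 < d)%N ->
  mu.-integrable [set: T] g ->
  (\int[mu]_x g (flip d x) = \int[mu]_x g x)%E.
Proof.
move=> d0 ig; have mg := measurable_int mu ig.
rewrite [LHS]integralE [RHS]integralE; congr (_ - _)%E.
  have <- := @ge0_integral_flip d (g^\+)%E d0 (measurable_funepos mg) (funepos_ge0 g).
  by rewrite funepos.unlock.
have <- := @ge0_integral_flip d (g^\-)%E d0 (measurable_funeneg mg) (funeneg_ge0 g).
by rewrite funeneg.unlock.
Qed.

End FlipInvariance.

(** * Rademacher atoms on dyadic cells *)

Section Atoms.
Context {R : realType}.
Local Notation T := (measurableTypeR R).
Local Notation mu := (lebesgue01 R).

Lemma lebesgue01_cell v : mu (cell v) = (2 ^- v.+1)%:E.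
Proof.
have p0 n : 0 < 2 ^+ n :> R by rewrite exprn_gt0.
rewrite lebesgue01E; last exact: measurable_cell.
have -> : cell v `&` `[0, 1[%classic = `[2 ^- v.+1, 2 ^- v[%classic :> set R.
  rewrite !set_itvco; apply/seteqP; split=> x; first by case.
  by move=> cx; split=> //; exact: (cell_unit cx).
rewrite lebesgue_measure_itv/= lte_fin ltf_pV2 ?posrE// ltr_eXn2l ?ltr1n// ltnSn.
by rewrite -EFinB; congr EFin; rewrite exprS; field; rewrite gt_eqF.
Qed.

Lemma lebesgue01T : mu [set: T] = 1%E.
Proof.
rewrite lebesgue01E// setTI lebesgue_measure_itv/= lte_fin ltr01.
by rewrite -EFinB subr0.
Qed.

Definition atom (theta : R) v d (x : R) : R :=
  (2 ^+ v.+1) `^ theta * (\1_(cell v) x * dyadic_sign d x).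

Lemma measurable_indic_cell v : measurable_fun [set: T] (\1_(cell v) : T -> R).
Proof. by apply: measurable_indic; exact: measurable_cell. Qed.

Lemma measurable_atom theta v d : measurable_fun [set: T] (atom theta v d : T -> R).
Proof.
apply: measurable_funM; first exact: measurable_cst.
apply: measurable_funM; first exact: measurable_indic_cell.
exact: measurable_dyadic_sign.
Qed.

Lemma normr_dyadic_sign d (x : R) : `|dyadic_sign d x| = 1.
Proof. by rewrite /dyadic_sign normrX normrN1 expr1n. Qed.

Lemma indic_cell v (x : R) : cell v x -> \1_(cell v) x = 1 :> R.
Proof. by move=> cx; rewrite indicE mem_set. Qed.

Lemma indic_notcell v (x : R) : ~ cell v x -> \1_(cell v) x = 0 :> R.
Proof. by move=> cx; rewrite indicE memNset. Qed.

Lemma atom_notcell theta v d x : ~ cell v x -> atom theta v d x = 0.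
Proof. by move=> cx; rewrite /atom indic_notcell// mul0r mulr0. Qed.

Lemma normr_atom theta v d x : cell v x ->
  `|atom theta v d x| = (2 ^+ v.+1) `^ theta.
Proof.
move=> cx; rewrite /atom indic_cell// mul1r normrM normr_dyadic_sign mulr1.
by rewrite ger0_norm// powR_ge0.
Qed.

Lemma normr_atom_le theta v d x : `|atom theta v d x| <= (2 ^+ v.+1) `^ theta.
Proof.
have [cx|cx] := pselect (cell v x); first by rewrite normr_atom.
by rewrite atom_notcell// normr0 powR_ge0.
Qed.

Lemma indic_cell_flip d v (x : R) : (v.+1 < d)%N ->
  \1_(cell v) (flip d x) = \1_(cell v) x :> R.
Proof.
move=> vd; have [x01|x01] := boolP (0 <= x < 1); last first.
  by rewrite /flip (negbTE x01).
have cf := cell_flip vd x01.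
have [cx|cx] := pselect (cell v x); first by rewrite !indic_cell//; exact/cf.
by rewrite !indic_notcell//; apply/cf.
Qed.

Lemma atom_flip theta v d d' x : (v.+1 < d')%N ->
  atom theta v d (flip d' x) = (-1) ^+ (d == d') * atom theta v d x.
Proof.
move=> vd; have [cx|cx] := pselect (cell v x); last first.
  by rewrite [in RHS]atom_notcell// mulr0 /atom indic_cell_flip// indic_notcell// mul0r mulr0.
rewrite /atom indic_cell_flip// dyadic_sign_flip//; first by ring.
  exact: leq_ltn_trans vd.
exact: cell_unit cx.
Qed.

Lemma atom_tail_flip theta v d d' x : (0 < d')%N -> (v.+1 < d)%N ->
  atom theta v d (tail_flip d' x) = (-1) ^+ (d == d') * atom theta v d x.
Proof.
move=> d0 vd.
have low m n : (m <= n)%N -> (2 ^- n : R) <= 2 ^- m.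
  by move=> mn; rewrite lef_pV2 ?posrE ?exprn_gt0// ler_eXn2l ?ltr1n.
have notcell (y : R) : cell v y -> (y < 2 ^- d'.-1) = ~~ (v.+1 < d')%N.
  move=> /andP[vy yv]; case: (ltnP v.+1 d') => /= vd'.
    apply/negbTE; rewrite -leNgt; apply: le_trans (low v.+1 d'.-1 _) vy; lia.
  apply: lt_le_trans yv (low d'.-1 v _); lia.
have [vd'|vd'] := boolP (v.+1 < d')%N.
  rewrite /tail_flip; case: ifPn => [xd|_]; last exact: atom_flip.
  have ncx : ~ cell v x by move=> /notcell; rewrite vd' xd.
  by rewrite atom_notcell// mulr0.
have -> : (d == d') = false by apply/negbTE; apply: contra vd' => /eqP <-.
rewrite expr0 mul1r /tail_flip; case: ifPn => // xd.
have ncx (y : R) : ~~ (y < 2 ^- d'.-1) -> ~ cell v y.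
  by move=> yd /notcell; rewrite (negbTE yd) vd'.
by rewrite !atom_notcell//; apply: ncx; rewrite ?flip_lt.
Qed.

Lemma integral_indic_cell v :
  (\int[mu]_x (\1_(cell v) x : R)%:E = (2 ^- v.+1)%:E)%E.
Proof. by rewrite integral_indic ?setIT ?lebesgue01_cell//; exact: measurable_cell. Qed.

Lemma powR_half_le (p u : R) : 0 < p <= 2 -> 0 <= u ->
  u `^ (p / 2) <= p / 2 * u + (1 - p / 2).
Proof.
move=> /andP[p0]; rewrite le_eqVlt => /predU1P[->|p2] u0.
  by rewrite divff// powRr1// mul1r subrr addr0.
have h := @conjugate_powR R (u `^ (p / 2)) 1 (2 / p) (1 - p / 2)^-1.
have -> : p / 2 * u + (1 - p / 2) =
  (u `^ (p / 2)) `^ (2 / p) / (2 / p) + 1 `^ (1 - p / 2)^-1 / (1 - p / 2)^-1.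
  rewrite -powRrM (_ : p / 2 * (2 / p) = 1); last by field; rewrite gt_eqF.
  by rewrite powRr1// powR1 div1r invrK invf_div mulrC.
rewrite -[leLHS]mulr1; apply: h => //.
- exact: powR_ge0.
- exact: divr_gt0.
- by rewrite invr_gt0; lra.
- by rewrite invrK invf_div; lra.
Qed.

Lemma Lnorm_le (p c : R) (f : T -> R) : 0 < p -> 0 <= c ->
  (\int[mu]_x (`|f x| `^ p)%:E <= c%:E)%E ->
  ('N[mu]_p%:E[EFin \o f] <= (c `^ p^-1)%:E)%E.
Proof.
move=> p0 c0 fc; rewrite unlock -poweR_EFin.
rewrite gt0_ler_poweR ?invr_ge0 ?(ltW p0)//.
- rewrite in_itv/= leey andbT integral_ge0// => x _; exact: poweR_ge0.
- by rewrite in_itv/= leey andbT lee_fin.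
Qed.

Section SignedSums.
Variables (n : nat) (s : nat -> bool) (v d : nat -> nat) (p theta : R).
Hypotheses (p1 : 1 <= p) (ptheta : theta * p = 1).

Definition signed_atoms (x : R) : R :=
  \sum_(i < n) (-1) ^+ s i * atom theta (v i) (d i) x.

Lemma measurable_signed_atoms : measurable_fun [set: T] (signed_atoms : T -> R).
Proof.
apply: measurable_sum => i; apply: measurable_funM => //.
exact: measurable_atom.
Qed.

Lemma measurable_pow_signed_atoms :
  measurable_fun [set: T] (fun x : T => (`|signed_atoms x| `^ p)%:E).
Proof.
apply/measurable_EFinP; apply: (measurableT_comp (measurable_powR _)).
by apply: measurableT_comp => //; exact: measurable_signed_atoms.
Qed.

Let p0 : 0 < p. Proof. exact: lt_le_trans p1. Qed.

Lemma pow_amplitude k : ((2 ^+ k.+1) `^ theta) `^ p = 2 ^+ k.+1 :> R.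
Proof. by rewrite -powRrM ptheta powRr1// exprn_ge0. Qed.

Lemma Lnorm_signed_atoms_disjoint :
  (forall i j, (i < n)%N -> (j < n)%N -> v i = v j -> i = j) ->
  ('N[mu]_p%:E[EFin \o signed_atoms] <= (n%:R `^ p^-1)%:E)%E.
Proof.
move=> v_inj; apply: Lnorm_le => //.
pose G (i : 'I_n) (x : T) : \bar R := (2 ^+ (v i).+1 * \1_(cell (v i)) x)%:E.
have mG i : measurable_fun [set: T] (G i).
  apply/measurable_EFinP; apply: measurable_funM => //.
  exact: measurable_indic_cell.
have G0 i x : (0 <= G i x)%E by rewrite lee_fin mulr_ge0// exprn_ge0.
apply: (@le_trans _ _ (\int[mu]_x (\sum_(i < n) G i x)%E)%E).
  apply: ge0_le_integral => //.
  - exact: measurable_pow_signed_atoms.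
  - by apply: emeasurable_sum => i; exact: mG.
  move=> x _; rewrite sumEFin lee_fin.
  have [[i cx]|ncx] := pselect (exists i : 'I_n, cell (v i) x); last first.
    rewrite /signed_atoms big1 => [|i _]; last first.
      by rewrite atom_notcell ?mulr0// => cx; apply: ncx; exists i.
    rewrite normr0 powR0 ?gt_eqF//; apply: sumr_ge0 => i _.
    by rewrite mulr_ge0// exprn_ge0.
  rewrite /signed_atoms (bigD1 i)//= big1 ?addr0 => [|j ji]; last first.
    rewrite atom_notcell ?mulr0// => cx'; move/eqP: ji; apply; apply/val_inj.
    exact: v_inj (cell_disj cx' cx).
  rewrite normrM normrX normrN1 expr1n mul1r normr_atom// pow_amplitude.
  rewrite (bigD1 i)//= indic_cell// mulr1 lerDl.
  by apply: sumr_ge0 => j _; rewrite mulr_ge0// exprn_ge0.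
rewrite ge0_integral_sum//.
rewrite (eq_bigr (fun=> 1%E)) => [|i _].
  by rewrite sumEFin sumr_const card_ord lee_fin.
rewrite /G; under eq_integral do rewrite EFinM.
rewrite ge0_integralZl_EFin//.
- by rewrite integral_indic_cell -EFinM mulfV// expf_neq0.
- apply/measurable_EFinP; exact: measurable_indic_cell.
Qed.

Section SameCell.
Variable w : nat.
Hypothesis vw : forall i, (i < n)%N -> v i = w.
Hypothesis d_inj : forall i j, (i < n)%N -> (j < n)%N -> d i = d j -> i = j.
Hypothesis d_gt : forall i, (i < n)%N -> (w.+1 < d i)%N.

Definition signed_digits m (x : R) : R :=
  \sum_(i < m) (-1) ^+ s i * dyadic_sign (d i) x.

Lemma signed_atomsE x : signed_atoms x =
  (2 ^+ w.+1) `^ theta * (\1_(cell w) x * signed_digits n x).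
Proof.
rewrite /signed_atoms /signed_digits !mulr_sumr; apply: eq_bigr => i _.
by rewrite /atom vw//; ring.
Qed.

Lemma measurable_signed_digits m :
  measurable_fun [set: T] (signed_digits m : T -> R).
Proof.
apply: measurable_sum => i; apply: measurable_funM => //.
exact: measurable_dyadic_sign.
Qed.

Lemma integral_signed_digits_sqr m : (m <= n)%N ->
  (\int[mu]_x (\1_(cell w) x * signed_digits m x ^+ 2 : R)%:E =
   (m%:R * 2 ^- w.+1)%:E)%E.
Proof.
elim: m => [_|m IH mn].
  rewrite mul0r -[RHS](integral0 mu [set: T]); apply: eq_integral => x _.
  by rewrite /signed_digits big_ord0 expr0n mulr0.
pose H k x : R := \1_(cell w) x * signed_digits k x ^+ 2.
have H0 k x : 0 <= H k x by rewrite mulr_ge0// sqr_ge0.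
have mH k : measurable_fun [set: T] (fun x : T => (H k x)%:E).
  apply/measurable_EFinP; apply: measurable_funM; first exact: measurable_indic_cell.
  by apply: measurable_funX; exact: measurable_signed_digits.
have dm := d_gt mn; have dm0 : (0 < d m)%N by exact: leq_ltn_trans dm.
have flipH x : H m.+1 (flip (d m) x) + H m.+1 x = 2 * (H m x + \1_(cell w) x).
  rewrite /H indic_cell_flip//.
  have [cx|cx] := pselect (cell w x); last by rewrite indic_notcell//; ring.
  rewrite indic_cell// !mul1r.
  have rflip k : (k <= m)%N -> dyadic_sign (d k) (flip (d m) x) =
      (-1) ^+ (k == m) * dyadic_sign (d k) x.
    move=> km; rewrite dyadic_sign_flip//; last exact: cell_unit cx.
    congr ((-1) ^+ nat_of_bool _ * _); apply/eqP/eqP => [|->//].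
    by apply: d_inj => //; exact: leq_ltn_trans km _.
  rewrite /signed_digits !big_ord_recr/= rflip// eqxx.
  rewrite (eq_bigr (fun i : 'I_m => (-1) ^+ s i * dyadic_sign (d i) x)) => [|i _]; last first.
    by rewrite rflip 1?ltnW// ltn_eqF// expr0 mul1r.
  set A := \sum_(i < m) _; set q := (-1) ^+ s m * dyadic_sign (d m) x.
  have q2 : q ^+ 2 = 1.
    rewrite -[LHS]ger0_norm ?sqr_ge0// normrX normrM normrX normrN1 expr1n.
    by rewrite normr_dyadic_sign mulr1 expr1n.
  rewrite expr1 mulN1r mulrN -/q.
  have -> : (A - q) ^+ 2 + (A + q) ^+ 2 = 2 * (A ^+ 2 + q ^+ 2) by ring.
  by rewrite q2.
have eqI : (\int[mu]_x (H m.+1 (flip (d m) x))%:E = \int[mu]_x (H m.+1 x)%:E)%E.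
  exact: (@ge0_integral_flip R (d m) (fun x : T => (H m.+1 x)%:E) dm0 (mH _) (fun x => H0 m.+1 x)).
have mHf : measurable_fun [set: T] (fun x : T => (H m.+1 (flip (d m) x))%:E).
  exact: measurableT_comp (mH m.+1) (@measurable_flip R (d m)).
have : (\int[mu]_x (H m.+1 x)%:E + \int[mu]_x (H m.+1 x)%:E =
    2%:E * (\int[mu]_x (H m x)%:E + \int[mu]_x (\1_(cell w) x)%:E))%E.
  rewrite -[X in (X + _)%E]eqI -ge0_integralD// => [|x _|x _]; rewrite ?lee_fin//.
  rewrite -ge0_integralD// => [|x _|]; rewrite ?lee_fin//; last first.
    by apply/measurable_EFinP; exact: measurable_indic_cell.
  rewrite -ge0_integralZl_EFin// => [|x _|].
  - by apply: eq_integral => x _; rewrite -!EFinD -EFinM flipH.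
  - by rewrite adde_ge0// lee_fin.
  - by apply: emeasurable_funD => //; apply/measurable_EFinP; exact: measurable_indic_cell.
rewrite integral_indic_cell IH 1?ltnW//.
case: (integral _ _ _) => [r||]//; rewrite -!EFinD -EFinM => -[rE].
by congr EFin; rewrite -natr1 mulrDl mul1r; lra.
Qed.

Lemma Lnorm_signed_atoms_same_cell : p <= 2 ->
  ('N[mu]_p%:E[EFin \o signed_atoms] <= (n%:R `^ 2^-1)%:E)%E.
Proof.
move=> p2; have [n0|n0] := posnP n.
  rewrite (_ : EFin \o signed_atoms = cst 0%E).
    by rewrite Lnorm0 ?lee_fin ?powR_ge0// gt_eqF.
  by apply/funext => x; rewrite /= /signed_atoms n0 big_ord0.
have nR : 0 < n%:R :> R by rewrite ltr0n.
have -> : n%:R `^ 2^-1 = (n%:R `^ (p / 2)) `^ p^-1 :> R.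
  by rewrite -powRrM; congr (_ `^ _); field; rewrite gt_eqF.
apply: Lnorm_le => //.
pose a := 2 ^+ w.+1 * n%:R `^ (p / 2) * (p / 2 / n%:R) : R.
pose b := 2 ^+ w.+1 * n%:R `^ (p / 2) * (1 - p / 2) : R.
have c0 : 0 <= 2 ^+ w.+1 * n%:R `^ (p / 2) :> R.
  by apply: mulr_ge0; [exact: exprn_ge0|exact: powR_ge0].
have a0 : 0 <= a.
  by apply: mulr_ge0 => //; apply: divr_ge0 => //; apply: divr_ge0 => //; exact: ltW.
have b0 : 0 <= b by apply: mulr_ge0 => //; rewrite subr_ge0 ler_pdivrMr// mul1r.
pose H x : R := \1_(cell w) x * signed_digits n x ^+ 2.
have H0 x : 0 <= H x by rewrite mulr_ge0// sqr_ge0.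
have mH : measurable_fun [set: T] (fun x : T => (H x)%:E).
  apply/measurable_EFinP; apply: measurable_funM; first exact: measurable_indic_cell.
  by apply: measurable_funX; exact: measurable_signed_digits.
have m1 : measurable_fun [set: T] (fun x : T => (\1_(cell w) x : R)%:E).
  by apply/measurable_EFinP; exact: measurable_indic_cell.
apply: (@le_trans _ _ (\int[mu]_x (a%:E * (H x)%:E + b%:E * (\1_(cell w) x)%:E)%E)%E).
  apply: ge0_le_integral => //.
  - exact: measurable_pow_signed_atoms.
  - by apply: emeasurable_funD; apply: measurable_funeM.
  move=> x _; rewrite -!EFinM -EFinD lee_fin signed_atomsE /H.
  have [cx|cx] := pselect (cell w x); last first.
    by rewrite indic_notcell// !(mul0r, mulr0) normr0 powR0 ?gt_eqF// addr0.
  rewrite indic_cell// !mul1r mulr1; set S := signed_digits n x.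
  rewrite normrM ger0_norm ?powR_ge0// powRM ?powR_ge0// pow_amplitude.
  have -> : `|S| `^ p = n%:R `^ (p / 2) * (S ^+ 2 / n%:R) `^ (p / 2).
    rewrite -powRM ?divr_ge0 ?sqr_ge0// mulrCA mulfV ?gt_eqF// mulr1.
    rewrite -[S ^+ 2]ger0_norm ?sqr_ge0// normrX -powR_mulrn// -powRrM.
    by congr (_ `^ _); field.
  have := @powR_half_le p (S ^+ 2 / n%:R).
  rewrite p0 p2 divr_ge0 ?sqr_ge0// => /(_ isT isT).
  move=> /(ler_wpM2l c0) h; rewrite mulrA; apply: le_trans h _.
  by rewrite le_eqVlt; apply/orP; left; apply/eqP; rewrite /a /b; field; rewrite gt_eqF.
rewrite ge0_integralD//; last 4 first.
- by move=> x _; rewrite mule_ge0 ?lee_fin.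
- exact: measurable_funeM.
- by move=> x _; rewrite mule_ge0 ?lee_fin.
- exact: measurable_funeM.
rewrite !ge0_integralZl_EFin//; last by move=> x _; rewrite lee_fin.
rewrite integral_signed_digits_sqr// integral_indic_cell -!EFinM -EFinD lee_fin.
rewrite le_eqVlt; apply/orP; left; apply/eqP.
by rewrite /a /b; field; rewrite expf_neq0// gt_eqF.
Qed.

End SameCell.
End SignedSums.
End Atoms.

(** * Atoms in L_q and their dual functionals *)

Section LqElements.
Context {R : realType}.
Local Notation T := (measurableTypeR R).
Local Notation mu := (lebesgue01 R).
Variables (q : R) (q1 : (1 <= q%:E)%E).
Local Notation Lf := (LfunType mu q1).
Local Notation Lq := (LspaceType mu q1).

Let q1R : 1 <= q. Proof. by move: q1; rewrite lee_fin. Qed.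
Let q0 : 0 < q. Proof. exact: lt_le_trans q1R. Qed.

Lemma bounded_Lfun (f : T -> R) (M : R) :
  measurable_fun [set: T] f -> (forall x, `|f x| <= M) -> f \in Lfun mu q%:E.
Proof.
move=> mf fM; have M0 : 0 <= M by exact: le_trans (fM 0).
apply/andP; split; first exact/mem_set.
apply/mem_set; apply: (@le_lt_trans _ _ ((M `^ q) `^ q^-1)%:E); last exact: ltry.
apply: Lnorm_le => //; first exact: powR_ge0.
apply: (@le_trans _ _ (\int[mu]_(x in [set: T]) (M `^ q)%:E)%E).
  apply: ge0_le_integral => //.
  - apply/measurable_EFinP; apply: (measurableT_comp (measurable_powR _)).
    exact: measurableT_comp.
  - by move=> x _; rewrite lee_fin ge0_ler_powR// ?nnegrE// ltW.
by rewrite integral_cst// lebesgue01T mule1.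
Qed.

Definition atomL v d : Lf :=
  Lfun_Sub q1 (bounded_Lfun (@measurable_atom R q^-1 v d) (@normr_atom_le R q^-1 v d)).

Definition atomLq v d : Lq := Lclass (atomL v d).

Lemma Lclass_sum n (c : nat -> R) (f : nat -> Lf) :
  \sum_(i < n) c i *: Lclass (f i) = Lclass (\sum_(i < n) c i *: f i).
Proof.
elim: n => [|n IH]; first by rewrite !big_ord0.
by rewrite !big_ord_recr/= IH -Lclass_add -Lclass_scale.
Qed.

Lemma Lfun_sumE n (c : nat -> R) (f : nat -> Lf) x :
  (\sum_(i < n) c i *: f i : Lf) x = \sum_(i < n) c i * f i x.
Proof.
elim: n => [|n IH]; first by rewrite !big_ord0.
by rewrite !big_ord_recr/= -IH.
Qed.

Lemma Lnorm_tail_flip d (f : T -> R) : (0 < d)%N -> measurable_fun [set: T] f ->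
  ('N[mu]_q%:E[EFin \o (f \o tail_flip d)] = 'N[mu]_q%:E[EFin \o f])%E.
Proof.
move=> d0 mf; rewrite unlock; congr (_ `^ _)%E.
apply: (@ge0_integral_tail_flip R d (fun x : T => (`|f x| `^ q)%:E)) => //.
apply/measurable_EFinP; apply: (measurableT_comp (measurable_powR _)).
exact: measurableT_comp.
Qed.

Lemma norm_flip_signs (f : nat -> Lf) (d : nat -> nat) :
  (forall k, (0 < d k)%N) ->
  (forall k l x, f k (tail_flip (d l) x) = (-1) ^+ (k == l) * f k x) ->
  forall n (s : nat -> bool),
  `|\sum_(k < n) (-1) ^+ s k *: Lclass (f k)| = `|\sum_(k < n) Lclass (f k)|.
Proof.
move=> d0 ff n s.
pose t m k := (k < m)%N && s k.
have step m : `|\sum_(k < n) (-1) ^+ t m.+1 k *: Lclass (f k)| =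
              `|\sum_(k < n) (-1) ^+ t m k *: Lclass (f k)|.
  have [sm|sm] := boolP (s m); last first.
    congr `| _ |; apply: eq_bigr => k _; rewrite /t ltnS leq_eqVlt.
    by case: eqP => [->|]; rewrite ?(negbTE sm) ?andbF.
  rewrite !(Lclass_sum n (fun k => (-1) ^+ t _ k) f).
  apply: EFin_inj; rewrite !norm_Lclass.
  rewrite -(Lnorm_tail_flip (d0 m)); last exact: (@measurable_funPT _ _ _ _ _).
  congr (Lnorm _ _ (EFin \o _)); apply/funext => x.
  have E j := Lfun_sumE n (fun k => (-1) ^+ t j k) f.
  apply: (etrans (E m.+1 (tail_flip (d m) x))); apply: (etrans _ (esym (E m x))).
  apply: eq_bigr => k _; rewrite ff /t ltnS mulrA; congr (_ * _).
  by case: ltngtP => [km|km|->]; rewrite ?sm /= ?expr0 ?expr1 ?mulN1r ?opprK ?mulr1 ?mul1r.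
have all_steps m : `|\sum_(k < n) (-1) ^+ t m k *: Lclass (f k)| =
                   `|\sum_(k < n) Lclass (f k)|.
  elim: m => [|m IH]; last by rewrite step.
  by congr `| _ |; apply: eq_bigr => k _; rewrite /t ltn0 expr0 scale1r.
rewrite -(all_steps n); congr `| _ |; apply: eq_bigr => k _.
by rewrite /t ltn_ord.
Qed.

Lemma norm_signed_atomsE n (s : nat -> bool) (v d : nat -> nat) :
  (`|\sum_(i < n) (-1) ^+ s i *: atomLq (v i) (d i)|%:E =
   'N[mu]_q%:E[EFin \o signed_atoms n s v d q^-1])%E.
Proof.
rewrite /atomLq (Lclass_sum n (fun i => (-1) ^+ s i) (fun i => atomL (v i) (d i))).
rewrite norm_Lclass; congr (Lnorm _ _ (EFin \o _)); apply/funext => x.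
exact: (Lfun_sumE n (fun i => (-1) ^+ s i) (fun i => atomL (v i) (d i))).
Qed.

Let qVq : q^-1 * q = 1. Proof. by rewrite mulVf// gt_eqF. Qed.

Lemma norm_atoms_disjoint n (s : nat -> bool) (v d : nat -> nat) :
  (forall i j, (i < n)%N -> (j < n)%N -> v i = v j -> i = j) ->
  `|\sum_(i < n) (-1) ^+ s i *: atomLq (v i) (d i)| <= n%:R `^ q^-1.
Proof.
by move=> v_inj; rewrite -lee_fin norm_signed_atomsE; exact: Lnorm_signed_atoms_disjoint.
Qed.

Lemma norm_atoms_same_cell n (s : nat -> bool) (v d : nat -> nat) w :
  (forall i, (i < n)%N -> v i = w) ->
  (forall i j, (i < n)%N -> (j < n)%N -> d i = d j -> i = j) ->
  (forall i, (i < n)%N -> (w.+1 < d i)%N) -> q <= 2 ->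
  `|\sum_(i < n) (-1) ^+ s i *: atomLq (v i) (d i)| <= n%:R `^ 2^-1.
Proof.
move=> vw d_inj d_gt q2; rewrite -lee_fin norm_signed_atomsE.
exact: (Lnorm_signed_atoms_same_cell s q1R qVq vw d_inj d_gt q2).
Qed.

Lemma Lq_integrable (y : Lq) : mu.-integrable [set: T] (EFin \o Lrepr y).
Proof.
apply/Lfun1_integrable; apply: (@Lfun_subset _ _ _ mu 1 q%:E) => //.
  by rewrite lebesgue01T.
exact: LfunP.
Qed.

Lemma bounded_integrable (f g : T -> R) (M : R) :
  mu.-integrable [set: T] (EFin \o f) ->
  measurable_fun [set: T] g -> (forall x, `|g x| <= M) ->
  mu.-integrable [set: T] (EFin \o (fun x => f x * g x)).
Proof.
move=> fi mg gM; rewrite (_ : _ \o _ = ((EFin \o f) \* (EFin \o g))%E)//.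
apply: integrableMl => //; exists M; split; first exact: num_real.
by move=> N MN x _; apply: le_trans (gM x) _; exact: ltW.
Qed.

Definition pairing (g : T -> R) (y : Lq) : R := \int[mu]_x (Lrepr y x * g x).

Lemma pairing_linear (g : T -> R) (M : R) : measurable_fun [set: T] g ->
  (forall x, `|g x| <= M) -> linear (pairing g : Lq -> R^o).
Proof.
move=> mg gM a y z.
have iy := bounded_integrable (Lq_integrable y) mg gM.
have iz := bounded_integrable (Lq_integrable z) mg gM.
suff: pairing g (a *: y + z) = a * pairing g y + pairing g z by [].
rewrite /pairing -RintegralZl// -RintegralD//; last first.
  exact: (integrableZl measurableT a iy).
congr fine; apply: ae_eq_integral => //.
- by apply: measurable_int; exact: (bounded_integrable (Lq_integrable (a *: y + z)) mg gM).
- apply/measurable_EFinP; apply: measurable_funD.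
    by apply: measurable_funM => //; apply/measurable_EFinP; exact: measurable_int iy.
  by apply/measurable_EFinP; exact: measurable_int iz.
have h1 := Lrepr_D (a *: y) z; have h2 := Lrepr_Z a y.
move: h1 h2; apply: filterS2 => x /(_ I) h1 /(_ I) h2 _ /=; congr EFin.
apply: etrans (congr1 (fun r => r * g x) h1) _.
apply: etrans (congr1 (fun r => (r + Lrepr z x) * g x) h2) _.
by rewrite /= -[_ *: _]/(a * Lrepr y x) mulrDl mulrA.
Qed.

Lemma pairing_Lclass (g : T -> R) (M : R) (f : Lf) : measurable_fun [set: T] g ->
  (forall x, `|g x| <= M) -> pairing g (Lclass f) = \int[mu]_x (f x * g x).
Proof.
move=> mg gM; congr fine; apply: ae_eq_integral => //.
- by apply: measurable_int; exact: (bounded_integrable (Lq_integrable (Lclass f)) mg gM).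
- by apply/measurable_EFinP; apply: measurable_funM => //; exact: (@measurable_funPT _ _ _ _ f).
have := Lrepr_class f; apply: filterS => x /(_ I) h _; congr EFin.
exact: (congr1 (fun r => r * g x) h).
Qed.

Lemma pairing_le1 (g : T -> R) (y : Lq) (M : R) : measurable_fun [set: T] g ->
  (forall x, `|g x| <= M) ->
  (`|pairing g y|%:E <= 'N[mu]_1[EFin \o (fun x => Lrepr y x * g x)%R])%E.
Proof.
move=> mg gM; have iy := bounded_integrable (Lq_integrable y) mg gM.
rewrite /pairing EFin_normr_Rintegral// Lnorm1.
apply: le_trans (le_abse_integral _ _ _) _ => //.
exact: measurable_int iy.
Qed.

Lemma pairing_hoelder (g : T -> R) (y : Lq) (M B : R) : 1 < q ->
  measurable_fun [set: T] g -> (forall x, `|g x| <= M) ->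
  ('N[mu]_((1 - q^-1)^-1)%:E[EFin \o g] <= B%:E)%E ->
  `|pairing g y| <= B * `|y|.
Proof.
move=> q_gt1 mg gM gB; rewrite -lee_fin.
apply: le_trans (pairing_le1 y mg gM) _.
have my : measurable_fun [set: T] (Lrepr y : T -> R) := @measurable_funPT _ _ _ _ (Lrepr y).
have c0 : 0 < 1 - q^-1 by rewrite subr_gt0 invf_lt1.
have h := @hoelder _ T R mu (Lrepr y) g q (1 - q^-1)^-1 my mg q0.
apply: le_trans (h _ _) _; rewrite ?invr_gt0 ?invrK ?subrKC//.
rewrite -norm_LspaceE mulrC EFinM.
by apply: lee_wpmul2l; rewrite ?lee_fin.
Qed.

Lemma pairing_bounded1 (g : T -> R) (y : Lq) : q = 1 ->
  measurable_fun [set: T] g -> (forall x, `|g x| <= 1) ->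
  `|pairing g y| <= `|y|.
Proof.
move=> qe mg gM; rewrite -lee_fin.
apply: le_trans (pairing_le1 y mg gM) _.
have my : measurable_fun [set: T] (Lrepr y : T -> R) := @measurable_funPT _ _ _ _ (Lrepr y).
rewrite norm_LspaceE; move: (Lrepr y : T -> R) my => h mh.
rewrite [in leRHS]qe !Lnorm1.
apply: ge0_le_integral => //.
- by apply/measurable_EFinP; apply: measurableT_comp => //; exact: measurable_funM.
- by apply/measurable_EFinP; exact: measurableT_comp.
by move=> x _; rewrite lee_fin normrM ler_piMr.
Qed.

End LqElements.

Section LqFunctionals.
Context {R : realType}.
Local Notation T := (measurableTypeR R).
Local Notation mu := (lebesgue01 R).
Variables (q : R) (q1 : (1 <= q%:E)%E).
Local Notation Lf := (LfunType mu q1).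
Local Notation Lq := (LspaceType mu q1).

Let q1R : 1 <= q. Proof. by move: q1; rewrite lee_fin. Qed.
Let q0 : 0 < q. Proof. exact: lt_le_trans q1R. Qed.

Definition atom_dual v d : Lq -> R^o := pairing (atom (1 - q^-1) v d).

Lemma atom_dual_linear v d : linear (atom_dual v d).
Proof. exact: pairing_linear (measurable_atom _ _ _) (normr_atom_le _ _ _). Qed.

HB.instance Definition _ v d :=
  GRing.isLinear.Build R Lq R^o _ (atom_dual v d) (atom_dual_linear v d).

Lemma atom_dual_atom v d v' d' : (v.+1 < d)%N -> (v'.+1 < d')%N ->
  atom_dual v d (atomLq q1 v' d') = ((v == v') && (d == d'))%:R.
Proof.
move=> vd vd'.
rewrite /atom_dual (pairing_Lclass _ (measurable_atom _ _ _) (normr_atom_le _ _ _)) /=.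
have [<-{v' vd'}|vv] := eqVneq v v'; last first.
  transitivity (\int[mu]_(x in [set: T]) (0 : R)); last by rewrite Rintegral_cst// mul0r.
  apply: eq_Rintegral => x _.
  have [cx|cx] := pselect (cell v x).
    by rewrite [X in X * _]atom_notcell ?mul0r// => /(cell_disj cx) /eqP; exact/negP.
  by rewrite [X in _ * X]atom_notcell ?mulr0.
have [<-{d'}|dd] := eqVneq d d'.
  rewrite (@eq_Rintegral _ _ _ mu setT (fun x => 2 ^+ v.+1 * \1_(cell v) x)) => [|x _].
    rewrite RintegralZl//; last first.
      apply/Lfun1_integrable; apply: (@Lfun_subset _ _ _ mu 1 q%:E) => //.
        by rewrite lebesgue01T.
      apply: (bounded_Lfun q1 (measurable_indic_cell v)) => x.
      by rewrite indicE; case: (_ \in _); rewrite ?normr0 ?normr1 ?ler01.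
    by rewrite /Rintegral integral_indic_cell /= mulfV// expf_neq0.
  have [cx|cx] := pselect (cell v x); last first.
    by rewrite atom_notcell// indic_notcell// mul0r mulr0.
  rewrite /atom indic_cell// !mul1r mulr1.
  have s2 : dyadic_sign d x * dyadic_sign d x = 1 :> R.
    by rewrite -expr2 -[LHS]ger0_norm ?sqr_ge0// normrX normr_dyadic_sign expr1n.
  rewrite mulrACA s2 mulr1 -powRD ?subrKC ?powRr1 ?exprn_ge0//.
  by rewrite expf_neq0 ?implybT.
set F := fun x : R => _ * _.
suff : \int[mu]_x F x = - \int[mu]_x F x by rewrite /= mulr0n; lra.
have iF : mu.-integrable [set: T] (EFin \o F).
  apply: bounded_integrable; last 2 first.
  - exact: measurable_atom.
  - exact: normr_atom_le.
  by apply/Lfun1_integrable; apply: (@Lfun_subset _ _ _ mu 1 q%:E) => //;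
    [rewrite lebesgue01T|exact: (LfunP (atomL q1 v d'))].
have d0 : (0 < d)%N by exact: leq_ltn_trans vd.
have FN x : F (flip d x) = - F x.
  by rewrite /F !atom_flip// eq_sym (negbTE dd) eqxx expr0 expr1 mul1r mulN1r mulrN.
rewrite -[LHS]/(fine (\int[mu]_x (F x)%:E)%E) -(integral_flip d0 iF).
rewrite -mulN1r -RintegralZl//; congr fine; apply: eq_integral => x _ /=.
by rewrite FN mulN1r.
Qed.

Lemma signed_atoms_bounded n (s : nat -> bool) (v d : nat -> nat) (theta : R) :
  exists M, forall x, `|signed_atoms n s v d theta x| <= M.
Proof.
exists (\sum_(i < n) (2 ^+ (v i).+1) `^ theta) => x.
apply: le_trans (ler_norm_sum _ _ _) _; apply: ler_sum => i _.
by rewrite normrM normrX normrN1 expr1n mul1r normr_atom_le.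
Qed.

Lemma atom_dual_signed n (s : nat -> bool) (v d : nat -> nat) (y : Lq) :
  \sum_(i < n) (-1) ^+ s i * atom_dual (v i) (d i) y =
  pairing (signed_atoms n s v d (1 - q^-1)) y.
Proof.
elim: n => [|n IH].
  rewrite big_ord0 /pairing.
  transitivity (\int[mu]_(x in [set: T]) (0 : R)); first by rewrite Rintegral_cst// mul0r.
  by apply: eq_Rintegral => x _; rewrite /signed_atoms big_ord0 mulr0.
rewrite big_ord_recr/= IH /atom_dual /pairing.
have [M SM] := signed_atoms_bounded n s v d (1 - q^-1).
have iS := bounded_integrable (Lq_integrable y)
  (measurable_signed_atoms n s v d (1 - q^-1)) SM.
have iA := bounded_integrable (Lq_integrable y)
  (measurable_atom (1 - q^-1) (v n) (d n)) (normr_atom_le _ _ _).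
rewrite -RintegralZl// -RintegralD//; last first.
  exact: (integrableZl measurableT ((-1) ^+ s n) iA).
by apply: eq_Rintegral => x _; rewrite /signed_atoms big_ord_recr/=; ring.
Qed.

Lemma atom_dual_disjoint n (s : nat -> bool) (v d : nat -> nat) (y : Lq) :
  (forall i j, (i < n)%N -> (j < n)%N -> v i = v j -> i = j) ->
  `|\sum_(i < n) (-1) ^+ s i * atom_dual (v i) (d i) y| <=
  n%:R `^ (1 - q^-1) * `|y|.
Proof.
move=> v_inj; rewrite atom_dual_signed.
have [M SM] := signed_atoms_bounded n s v d (1 - q^-1).
have mS := measurable_signed_atoms n s v d (1 - q^-1).
move: q1R; rewrite le_eqVlt => /predU1P[qe|q_gt1]; last first.
  have c0 : 0 < 1 - q^-1 by rewrite subr_gt0 invf_lt1.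
  apply: pairing_hoelder SM _ => //.
  rewrite -[X in (_ <= (_ `^ X)%:E)%E]invrK.
  apply: Lnorm_signed_atoms_disjoint => //; last by rewrite mulfV ?gt_eqF.
  by rewrite invf_ge1// gerBl invr_ge0 ltW.
have -> : 1 - q^-1 = 0 by rewrite -qe invr1 subrr.
rewrite powRr0 mul1r; apply: pairing_bounded1 => // [|x].
  exact: measurable_signed_atoms.
have [[i cx]|ncx] := pselect (exists i : 'I_n, cell (v i) x); last first.
  rewrite /signed_atoms big1 ?normr0// => i _.
  by rewrite atom_notcell ?mulr0// => cx; apply: ncx; exists i.
rewrite /signed_atoms (bigD1 i)//= big1 ?addr0 => [|j ji]; last first.
  rewrite atom_notcell ?mulr0// => cx'; move/eqP: ji; apply; apply/val_inj.
  exact: v_inj (cell_disj cx' cx).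
by rewrite normrM normrX normrN1 expr1n mul1r normr_atom// powRr0.
Qed.

Lemma atom_dual_same_cell n (s : nat -> bool) (v d : nat -> nat) w (y : Lq) :
  (forall i, (i < n)%N -> v i = w) ->
  (forall i j, (i < n)%N -> (j < n)%N -> d i = d j -> i = j) ->
  (forall i, (i < n)%N -> (w.+1 < d i)%N) -> 2 <= q ->
  `|\sum_(i < n) (-1) ^+ s i * atom_dual (v i) (d i) y| <= n%:R `^ 2^-1 * `|y|.
Proof.
move=> vw d_inj d_gt q2; rewrite atom_dual_signed.
have [M SM] := signed_atoms_bounded n s v d (1 - q^-1).
have mS := measurable_signed_atoms n s v d (1 - q^-1).
have q_gt1 : 1 < q by lra.
have q_half : q^-1 <= 2^-1 by rewrite lef_pV2 ?posrE.
have c0 : 0 < 1 - q^-1 by lra.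
apply: pairing_hoelder SM _ => //.
apply: (Lnorm_signed_atoms_same_cell s _ _ vw d_inj d_gt).
- by rewrite invf_ge1// gerBl invr_ge0 ltW.
- by rewrite mulfV ?gt_eqF.
- by rewrite -[2]invrK lef_pV2 ?posrE ?invr_gt0//; lra.
Qed.

Lemma atom_dual_continuous v d : continuous (atom_dual v d).
Proof.
apply/linear_bounded_continuous/linear_boundedP; near=> r => y.
apply: (@le_trans _ _ (1 * `|y|)); last first.
  by rewrite ler_wpM2r//; near: r; exact: nbhs_pinfty_ge.
have := @atom_dual_disjoint 1 xpred0 (fun=> v) (fun=> d) y.
rewrite big_ord1 expr0 mul1r powR1; apply.
by move=> i j; rewrite !ltnS !leqn0 => /eqP-> /eqP->.
Unshelve. all: by end_near. Qed.

End LqFunctionals.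

(** * Closed spans *)

Section ClosedSpan.
Context {R : realType} (E : normedModType R).
Variables (e : 'I_2 -> nat -> E) (f : 'I_2 -> nat -> {linear E -> R^o}).
Local Notation proj := (blockproj e f).
Hypothesis biorth :
  forall i j k l, f i k (e j l) = ((i == j) && (k == l))%:R.
Hypothesis f_continuous : forall i k, continuous (f i k).
Hypothesis sign_invariant : forall n (s : nat -> bool) y,
  `|\sum_(k < n) (-1) ^+ s k *: proj k y| = `|\sum_(k < n) proj k y|.

Definition block_span : {pred E} :=
  mem [set y | series (fun k => proj k y) @ \oo --> y].

Lemma block_spanP y :
  reflect (series (fun k => proj k y) @ \oo --> y) (y \in block_span).
Proof. by apply: (iffP idP) => [/set_mem|/mem_set]. Qed.

Lemma block_span_submod_closed : submod_closed block_span.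
Proof.
split=> [|a x y /block_spanP cx /block_spanP cy]; apply/block_spanP.
  rewrite (_ : series _ = cst 0); first exact: cvg_cst.
  apply/funext => n; rewrite /series/= big1// => k _; exact: linear0.
rewrite (_ : series _ = (a \*: series (fun k => proj k x)) \+
                        series (fun k => proj k y)).
  by apply: cvgD => //; apply: cvgZl_tmp.
apply/funext => n; rewrite /series/= scaler_sumr -big_split/=.
by apply: eq_bigr => k _; rewrite linearP.
Qed.

HB.instance Definition _ :=
  GRing.isSubmodClosed.Build R E block_span block_span_submod_closed.

(* The partial sums with signs [+1] and with signs changed from [m] on have the
   [m]-th partial sum as their mean. *)
Lemma norm_partial_sum m n y : (m <= n)%N ->
  `|\sum_(k < m) proj k y| <= `|\sum_(k < n) proj k y|.
Proof.
move=> mn; set N := leRHS.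
have s2 : 2 *: \sum_(k < m) proj k y =
    \sum_(k < n) proj k y + \sum_(k < n) (-1) ^+ (m <= k)%N *: proj k y.
  rewrite -big_split/= (big_ord_widen n (fun k => proj k y) mn).
  rewrite scaler_sumr big_mkcond/=; apply: eq_bigr => k _.
  by case: ltnP => _; rewrite ?scale1r ?scaleN1r ?subrr// scaler_nat mulr2n.
rewrite -(ler_pM2l (ltr0n R 2)) -[X in X * `|\sum__ _| ](@normr_nat R) -normrZ s2.
rewrite (le_trans (ler_normD _ _))// (sign_invariant n (fun k => (m <= k)%N)).
by rewrite mulr_natl mulr2n.
Qed.

Lemma norm_partial_sum_le m y : y \in block_span ->
  `|\sum_(k < m) proj k y| <= `|y|.
Proof.
move=> /block_spanP cy.
have h : (fun n => `|series (fun k => proj k y) n|) @ \oo --> `|y|.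
  by apply: cvg_norm.
rewrite -(cvg_lim (@norm_hausdorff _ R^o) h).
apply: limr_ge; first exact: cvgP h.
near=> n; rewrite /series/= big_mkord; apply: norm_partial_sum.
by near: n; exact: nbhs_infty_ge.
Unshelve. all: by end_near. Qed.

Lemma partial_sum_continuous m : continuous (fun y => \sum_(k < m) proj k y).
Proof.
move=> y; apply: cvg_sumr => k; exact: (blockproj_continuous f_continuous).
Qed.

Lemma closed_block_span : closed [set` block_span].
Proof.
move=> y cl_y; apply/block_spanP; apply/cvgrPdist_le => eps eps0.
have eps8 : 0 < eps / 8 by rewrite divr_gt0.
have near_y z0 : 0 < z0 -> exists2 z, z \in block_span & `|y - z| < z0.
  move=> z00; have [z [Vz /= yz]] := cl_y _ (nbhsx_ballx y z0 z00).
  by exists z => //; rewrite -ball_normE in yz.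
have [z Vz yz] := near_y _ eps8.
have Syz m : `|\sum_(k < m) proj k y - \sum_(k < m) proj k z| <= eps / 2.
  (* [y] is approximated by [z'] in the span, where the partial sums contract *)
  have /cvgrPdist_lt/(_ _ eps8)/nbhs_ballP[r /= r0 rS] := @partial_sum_continuous m y.
  have m0 : 0 < Num.min r (eps / 8) by rewrite lt_min r0.
  have [z' Vz' yz'] := near_y _ m0.
  have [yr yeps] : `|y - z'| < r /\ `|y - z'| < eps / 8.
    by move: yz'; rewrite lt_min => /andP.
  have h1 : `|\sum_(k < m) proj k y - \sum_(k < m) proj k z'| < eps / 8.
    by apply: rS; rewrite -ball_normE.
  have h2 : `|\sum_(k < m) proj k z' - \sum_(k < m) proj k z| <= `|z' - z|.
    rewrite (_ : _ - _ = \sum_(k < m) proj k (z' - z)).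
      by apply: norm_partial_sum_le; exact: rpredB.
    by rewrite -sumrB; apply: eq_bigr => k _; rewrite linearB.
  have h3 := ler_distD y z' z; rewrite [`|z' - y|]distrC in h3.
  have h4 := ler_distD (\sum_(k < m) proj k z')
    (\sum_(k < m) proj k y) (\sum_(k < m) proj k z).
  move: h1 h2 h3 h4 yeps yz; lra.
have /block_spanP/cvgrPdist_le/(_ _ eps8) := Vz.
apply: filterS => n; rewrite /series/= !big_mkord => zn.
have h1 := ler_distD z y (\sum_(k < n) proj k y).
have h2 := ler_distD (\sum_(k < n) proj k z) z (\sum_(k < n) proj k y).
have h3 := Syz n; rewrite distrC in h3.
move: yz zn h1 h2 h3; lra.
Qed.

Lemma block_span_e i k : e i k \in block_span.
Proof.
apply/block_spanP; apply: cvg_near_cst; near=> n.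
have kn : (k < n)%N by near: n; exact: nbhs_infty_gt.
rewrite /series/= big_mkord (bigD1 (Ordinal kn))//= (blockproj_e biorth) eqxx scale1r.
rewrite big1 ?addr0// => j jk; rewrite (blockproj_e biorth).
by rewrite -(inj_eq val_inj)/= in jk; rewrite (negPf jk) scale0r.
Unshelve. all: by end_near. Qed.

Local Notation Y := (linsub block_span).

Definition span_e i k : Y := exist _ (e i k) (block_span_e i k).

Definition span_f i k : {linear Y -> R^o} := f i k \o (val : Y -> E).

Lemma span_biorth i j k l :
  span_f i k (span_e j l) = ((i == j) && (k == l))%:R.
Proof. exact: biorth. Qed.

Lemma span_val_continuous : continuous (val : Y -> E).
Proof.
apply/(linear_bounded_continuous (val : {linear Y -> E}))/linear_boundedP.
near=> r => y; apply: (@le_trans _ _ (1 * `|y|)).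
  by rewrite mul1r; exact: lexx.
by rewrite ler_wpM2r//; near: r; exact: nbhs_pinfty_ge.
Unshelve. all: by end_near. Qed.

Lemma span_f_continuous i k : continuous (span_f i k).
Proof.
move=> y; apply: continuous_comp; first exact: span_val_continuous.
exact: f_continuous.
Qed.

Lemma val_span_blockproj k (y : Y) :
  val (blockproj span_e span_f k y) = proj k (val y).
Proof.
rewrite /blockproj [LHS](linear_sum (val : {linear Y -> E})).
by apply: eq_bigr => i _; exact: (linearZ_LR (val : {linear Y -> E})).
Qed.

Lemma span_blockproj_cvg y :
  series (fun k => blockproj span_e span_f k y) @ \oo --> y.
Proof.
apply/cvgrPdist_le => eps eps0.
have /block_spanP/cvgrPdist_le/(_ _ eps0) := valP y.
apply: filterS => n; apply: le_trans; rewrite le_eqVlt; apply/orP; left.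
apply/eqP; rewrite -[LHS]/(`|val (y - _)|); congr `| _ |.
rewrite [LHS](linearB (val : {linear Y -> E})); congr (_ - _).
rewrite /series/= [LHS](linear_sum (val : {linear Y -> E})).
by apply: eq_bigr => k _; exact: val_span_blockproj.
Qed.

Lemma span_blockproj_uncond n (s : nat -> bool) y :
  `|\sum_(k < n) (-1) ^+ s k *: blockproj span_e span_f k y| <= `|y|.
Proof.
rewrite -[leLHS]/(`|val (\sum_(k < n) (-1) ^+ s k *: blockproj span_e span_f k y)|).
rewrite [X in `|X|](linear_sum (val : {linear Y -> E})).
rewrite (eq_bigr (fun k : 'I_n => (-1) ^+ s k *: proj k (val y))) => [|k _].
  by rewrite sign_invariant; apply: norm_partial_sum_le; exact: valP.
rewrite [LHS](linearZ_LR (val : {linear Y -> E})); congr (_ *: _).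
exact: val_span_blockproj.
Qed.

End ClosedSpan.

(** * Blocks indexed by labels *)

Section LabelledBlocks.
Context {R : realType}.
Variables (q : R) (q1 : (1 <= q%:E)%E) (lab : 'I_3 -> nat -> nat).
Local Notation T := (measurableTypeR R).
Local Notation Lq := (LspaceType (lebesgue01 R) q1).

Definition cell_index (m : 'I_3) k := (lab m k * 3 + m)%N.

(* The digit of a block lies beyond all its cells, so that flipping it preserves
   them. *)
Definition digit k := (\sum_(i < k.+1) (\sum_(m < 3) cell_index m i).+2)%N.

Lemma cell_index_inj m m' k k' : cell_index m k = cell_index m' k' ->
  m = m' /\ lab m k = lab m' k'.
Proof.
move=> h; have mm : m = m' :> nat.
  have := congr1 (modn^~ 3) h; rewrite /cell_index !modnMDl.
  by rewrite !modn_small// ltn_ord.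
split; first exact: val_inj.
by move: h; rewrite /cell_index mm => /addIn /eqP; rewrite eqn_pmul2r// => /eqP.
Qed.

Lemma digit_gt m k : ((cell_index m k).+1 < digit k)%N.
Proof.
rewrite /digit big_ord_recr/=; apply: (@leq_trans (\sum_(m < 3) cell_index m k).+2).
  by rewrite ltnS ltnS (bigD1 m)//= leq_addr.
exact: leq_addl.
Qed.

Lemma digit_inj : injective digit.
Proof.
have mono k l : (k < l)%N -> (digit k < digit l)%N.
  elim: l => // l IH; rewrite ltnS leq_eqVlt => /predU1P[->|/IH kl].
    by rewrite {2}/digit big_ord_recr/= -/(digit l) -addSnnS leq_addr.
  apply: ltn_trans kl _.
  by rewrite {2}/digit big_ord_recr/= -/(digit l) -addSnnS leq_addr.
move=> k l kl; case: (ltngtP k l) => // /mono; by rewrite kl ltnn.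
Qed.

Lemma digit_gt0 k : (0 < digit k)%N.
Proof. exact: leq_ltn_trans (digit_gt ord0 k). Qed.

Definition component m k : Lq := atomLq q1 (cell_index m k) (digit k).

Definition component_dual m k : {linear Lq -> R^o} :=
  atom_dual (q1 := q1) (cell_index m k) (digit k).

Lemma component_dualE m m' k k' :
  component_dual m k (component m' k') = ((m == m') && (k == k'))%:R.
Proof.
apply: etrans (atom_dual_atom q1 (digit_gt m k) (digit_gt m' k')) _.
congr (nat_of_bool _)%:R; apply/andP/andP => [[/eqP/cell_index_inj[<- _] /eqP/digit_inj<-]|].
  by rewrite !eqxx.
by move=> [/eqP<- /eqP<-]; rewrite !eqxx.
Qed.

Definition fst_component (i : 'I_2) : 'I_3 := widen_ord (leqnSn 2) i.

(* The component [ord_max] is shared by the two vectors of a block; the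
   difference of these two vectors is the combination without it. *)
Definition blk_e (i : 'I_2) k : Lq :=
  component (fst_component i) k + component ord_max k.

Definition blk_f (i : 'I_2) k : {linear Lq -> R^o} :=
  component_dual (fst_component i) k.

Lemma fst_component_neq i : (fst_component i == ord_max) = false.
Proof. by apply/negbTE; rewrite -(inj_eq val_inj)/= neq_ltn ltn_ord. Qed.

Lemma blk_biorth i j k l : blk_f i k (blk_e j l) = ((i == j) && (k == l))%:R.
Proof.
rewrite /blk_f /blk_e linearD !component_dualE fst_component_neq addr0.
by rewrite -[fst_component i == _](inj_eq val_inj).
Qed.

Lemma blk_f_continuous i k : continuous (blk_f i k).
Proof. exact: atom_dual_continuous. Qed.

Local Notation proj := (blockproj blk_e blk_f).

Lemma blk_sign_invariant n (s : nat -> bool) y :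
  `|\sum_(k < n) (-1) ^+ s k *: proj k y| = `|\sum_(k < n) proj k y|.
Proof.
pose A m k := atomL q1 (cell_index m k) (digit k).
pose F k : LfunType (lebesgue01 R) q1 :=
  (blk_f ord0 k y : R) *: (A (fst_component ord0) k + A ord_max k) +
  (blk_f ord_max k y : R) *: (A (fst_component ord_max) k + A ord_max k).
have FE k : proj k y = Lclass (F k).
  by rewrite blockprojE -Lclass_add -!Lclass_scale -!Lclass_add.
under eq_bigr do rewrite FE; under [in RHS]eq_bigr do rewrite FE.
apply: (@norm_flip_signs R q q1 F digit) => [k|k l x]; first exact: digit_gt0.
have Aflip m : A m k (tail_flip (digit l) x) = (-1) ^+ (k == l) * A m k x.
  rewrite -(inj_eq digit_inj); apply: atom_tail_flip; first exact: digit_gt0.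
  exact: digit_gt.
have Feval z : F k z =
    blk_f ord0 k y * (A (fst_component ord0) k z + A ord_max k z) +
    blk_f ord_max k y * (A (fst_component ord_max) k z + A ord_max k z) by [].
by rewrite !Feval !Aflip; ring.
Qed.

Local Notation V := (block_span blk_e blk_f).
Local Notation Y := (linsub V).
Local Notation eY := (span_e blk_biorth).
Local Notation fY := (span_f blk_e blk_f).

Lemma component_dual_span k y : y \in V ->
  component_dual ord_max k y = blk_f ord0 k y + blk_f ord_max k y.
Proof.
move=> /block_spanP cy.
have h (g : {linear Lq -> R^o}) : continuous g ->
    (fun n => g (series (fun k => proj k y) n)) @ \oo --> g y.
  by move=> cg; apply: continuous_cvg => //; exact: cg.
have h0 := h _ (@blk_f_continuous ord0 k).
have h1 := h _ (@blk_f_continuous ord_max k).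
have hm := h _ (@atom_dual_continuous R q q1 (cell_index ord_max k) (digit k)).
have hs : (fun n => blk_f ord0 k (series (fun k => proj k y) n) +
                    blk_f ord_max k (series (fun k => proj k y) n)) @ \oo -->
          blk_f ord0 k y + blk_f ord_max k y by exact: cvgD h0 h1.
rewrite -(cvg_lim (@norm_hausdorff _ R^o) hs) -[LHS](cvg_lim (@norm_hausdorff _ R^o) hm).
congr (limn _); apply/funext => n.
rewrite /series/= !linear_sum -big_split/=; apply: eq_bigr => l _.
have E m : component_dual m k (proj l y) =
    \sum_(i < 2) blk_f i l y * component_dual m k (blk_e i l).
  by rewrite /blockproj linear_sum; apply: eq_bigr => i _; rewrite linearZ.
rewrite -[LHS]/(component_dual ord_max k (proj l y)).
rewrite -[X in _ = X + _]/(component_dual (fst_component ord0) k (proj l y)).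
rewrite -[X in _ = _ + X]/(component_dual (fst_component ord_max) k (proj l y)).
rewrite !E -big_split/=; apply: eq_bigr => i _; rewrite -mulrDr; congr (_ * _).
have neq j : (ord_max == fst_component j) = false by rewrite eq_sym fst_component_neq.
rewrite /blk_e !linearD !component_dualE eqxx !neq !fst_component_neq /= add0r !addr0.
case: i => -[|[|//]] ilt; rewrite -!(inj_eq val_inj)/=.
  by rewrite addr0.
by rewrite add0r.
Qed.

Definition line_estimate (al be : R) n m (h : nat -> nat) : Prop :=
  (forall m', m' != m -> forall s : nat -> bool,
     `|\sum_(i < n) (-1) ^+ s i *: component m' (h i)| <= al) /\
  (forall (s : nat -> bool) y,
     `|\sum_(i < n) (-1) ^+ s i * component_dual m (h i) y| <= be * `|y|).

Lemma line_estimate_lt2 n m h : q <= 2 ->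
  (forall i j, (i < n)%N -> (j < n)%N -> h i = h j -> i = j) ->
  (forall i j, (i < n)%N -> (j < n)%N -> lab m (h i) = lab m (h j) -> i = j) ->
  (forall m', m' != m -> exists w, forall i, (i < n)%N -> lab m' (h i) = w) ->
  line_estimate (n%:R `^ 2^-1) (n%:R `^ (1 - q^-1)) n m h.
Proof.
move=> q2 h_inj l_inj l_cst; split=> [m' /l_cst[w lw] s|s y]; last first.
  apply: (@atom_dual_disjoint R q q1 n s (fun i => cell_index m (h i))
    (fun i => digit (h i))) => i j ni nj /cell_index_inj[_]; exact: l_inj.
apply: (@norm_atoms_same_cell R q q1 n s (fun i => cell_index m' (h i))
    (fun i => digit (h i)) (w * 3 + m')%N) => //.
- by move=> i ni; rewrite /cell_index lw.
- by move=> i j ni nj /digit_inj; exact: h_inj.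
- by move=> i ni; rewrite -(lw i ni); exact: digit_gt.
Qed.

Lemma line_estimate_gt2 n m h : 2 <= q ->
  (forall i j, (i < n)%N -> (j < n)%N -> h i = h j -> i = j) ->
  (exists w, forall i, (i < n)%N -> lab m (h i) = w) ->
  (forall m', m' != m -> forall i j, (i < n)%N -> (j < n)%N ->
     lab m' (h i) = lab m' (h j) -> i = j) ->
  line_estimate (n%:R `^ q^-1) (n%:R `^ 2^-1) n m h.
Proof.
move=> q2 h_inj [w lw] l_inj; split=> [m' m'm s|s y].
  apply: (@norm_atoms_disjoint R q q1 n s (fun i => cell_index m' (h i))
    (fun i => digit (h i))) => i j ni nj /cell_index_inj[_]; exact: l_inj.
apply: (@atom_dual_same_cell R q q1 n s (fun i => cell_index m (h i))
    (fun i => digit (h i)) (w * 3 + m)%N) => //.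
- by move=> i ni; rewrite /cell_index lw.
- by move=> i j ni nj /digit_inj; exact: h_inj.
- by move=> i ni; rewrite -(lw i ni); exact: digit_gt.
Qed.

Lemma labelled_blocks_subspace :
  (forall C : R, exists n G (al be : R),
    [/\ 0 <= al, 0 <= be, 48 * C * (al * be) < n%:R & forall i j,
      [/\ line_estimate al be n (fst_component ord0) (fun k => G k i j),
          line_estimate al be n (fst_component ord_max) (fun k => G i k j) &
          line_estimate al be n ord_max (fun k => G i j k)]]) ->
  exists W : submodClosed Lq,
    [/\ closed [set` W], ~ local_unconditional_structure (linsub W),
        has_2dim_unconditional_decomposition (linsub W) & gordon_lewis (linsub W)].
Proof.
move=> lines; exists (V : submodClosed Lq).
have cvgY := span_blockproj_cvg blk_biorth.
have uncY := span_blockproj_uncond blk_biorth blk_sign_invariant.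
have ctsY := span_f_continuous (e := blk_e) blk_f_continuous.
split.
- exact: closed_block_span blk_f_continuous blk_sign_invariant.
- apply: (@not_local_unconditional_structure R Y eY fY).
  + exact: span_biorth.
  + exact: ctsY.
  move=> C; have [n [G [al [be [al0 be0 nC GE]]]]] := lines C.
  exists n, G, (2 * al), be; split=> //; first exact: mulr_ge0.
    by move: nC; rewrite (_ : 24 * _ = 48 * C * (al * be))//; ring.
  have two (s : nat -> bool) (c1 c2 : 'I_3) (h : nat -> nat) (b : bool) :
      `|\sum_(i < n) (-1) ^+ s i *: component c1 (h i)| <= al ->
      `|\sum_(i < n) (-1) ^+ s i *: component c2 (h i)| <= al ->
      `|\sum_(i < n) (-1) ^+ s i *:
          (component c1 (h i) + (-1) ^+ b *: component c2 (h i))| <= 2 * al.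
    move=> h1 h2.
    rewrite (eq_bigr (fun i : 'I_n => (-1) ^+ s i *: component c1 (h i) +
      (-1) ^+ b *: ((-1) ^+ s i *: component c2 (h i)))) => [|i _]; last first.
      by rewrite scalerDr !scalerA mulrC.
    rewrite big_split/= -scaler_sumr (le_trans (ler_normD _ _))//.
    by rewrite normrZ normrX normrN1 expr1n mul1r mulr_natl mulr2n lerD.
  have valsum (s : nat -> bool) (z : nat -> Y) (x : nat -> Lq) :
      (forall i, val (z i) = x i) ->
      `|\sum_(i < n) (-1) ^+ s i *: z i| = `|\sum_(i < n) (-1) ^+ s i *: x i|.
    move=> zx; rewrite -[LHS]/(`|val (\sum_(i < n) (-1) ^+ s i *: z i)|).
    congr `| _ |; rewrite [LHS](linear_sum (val : {linear Y -> Lq})).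
    apply: eq_bigr => i _; rewrite -zx.
    exact: (linearZ_LR (val : {linear Y -> Lq})).
  move=> i j; have [[x0 f0] [x1 f1] [x2 f2]] := GE i j; split.
  + split=> [s|s y]; last exact: (f0 s (val y)).
    rewrite [leLHS](valsum s (fun k => eY ord_max (G k i j)) (fun k =>
      component (fst_component ord_max) (G k i j) +
      (-1) ^+ false *: component ord_max (G k i j))) => [|k].
      by apply: (two s _ _ (fun k => G k i j)); exact: x0.
    by rewrite expr0 scale1r.
  + split=> [s|s y]; last exact: (f1 s (val y)).
    rewrite [leLHS](valsum s (fun k => eY ord0 (G i k j)) (fun k =>
      component (fst_component ord0) (G i k j) +
      (-1) ^+ false *: component ord_max (G i k j))) => [|k].
      by apply: (two s _ _ (fun k => G i k j)); exact: x1.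
    by rewrite expr0 scale1r.
  split=> [s|s y].
    rewrite [leLHS](valsum s (fun k => eY ord0 (G i j k) - eY ord_max (G i j k))
      (fun k => component (fst_component ord0) (G i j k) +
      (-1) ^+ true *: component (fst_component ord_max) (G i j k))) => [|k].
      by apply: (two s _ _ (fun k => G i j k)); apply: x2; rewrite fst_component_neq.
    rewrite [LHS](linearB (val : {linear Y -> Lq})) expr1 scaleN1r.
    rewrite /= /blk_e opprD addrACA subrr addr0; congr (_ - component _ _).
  apply: le_trans (f2 s (val y)); rewrite le_eqVlt; apply/orP; left; apply/eqP.
  congr `| _ |; apply: eq_bigr => k _; congr (_ * _).
  by apply/esym; apply: component_dual_span; exact: valP.
- exact: (two_dim_unconditional_decomposition (span_biorth blk_biorth) ctsY cvgY uncY).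
- exact: (gordon_lewis_of_blocks cvgY uncY).
Qed.

End LabelledBlocks.

Definition coords (k : nat) : nat * nat * nat := odflt (0, 0, 0)%N (unpickle k).

Definition grid (a b c : nat) : nat := pickle (a, b, c).

Lemma coords_grid a b c : coords (grid a b c) = (a, b, c).
Proof. by rewrite /coords pickleK. Qed.

Definition coord_label (m : 'I_3) (k : nat) : nat :=
  match val m with
  | 0 => (coords k).1.1 | 1 => (coords k).1.2 | _ => (coords k).2
  end.

Definition colabel (m : 'I_3) (k : nat) : nat :=
  match val m with
  | 0 => pickle ((coords k).1.2, (coords k).2)
  | 1 => pickle ((coords k).1.1, (coords k).2)
  | _ => pickle (coords k).1
  end.

Lemma large_power {R : realType} (C al be : R) : al + be < 1 ->
  exists n : nat, C * (n%:R `^ al * n%:R `^ be) < n%:R.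
Proof.
move=> ab; set ep := 1 - (al + be); have ep0 : 0 < ep by rewrite subr_gt0.
pose X := `|C| + 1; have X0 : 0 < X by rewrite ltr_pwDr.
pose n := (Num.truncn (X `^ ep^-1)).+1.
have nX : X `^ ep^-1 < n%:R by exact: truncnS_gt.
have n0 : 0 < n%:R :> R by rewrite ltr0n.
exists n; have nE : n%:R = n%:R `^ ep * (n%:R `^ al * n%:R `^ be) :> R.
  by rewrite -!powRD ?(gt_eqF n0) ?implybT// /ep subrK powRr1// ltW.
rewrite [ltRHS]nE ltr_pM2r ?mulr_gt0 ?powR_gt0//.
apply: le_lt_trans (ler_norm C) _; apply: (@lt_trans _ _ X).
  by rewrite ltrDl.
have := gt0_ltr_powR ep0 (powR_ge0 _ _) (ltW n0) nX.
by rewrite -powRrM mulVf ?gt_eqF// powRr1// ltW.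
Qed.

Theorem mainTheorem7 (R : realType) (q : R) (q1 : (1 <= q%:E)%E) (q2 : q != 2) :
  exists Y : submodClosed (LspaceType (lebesgue01 R) q1),
    [/\ closed [set` Y],
        ~ local_unconditional_structure (linsub Y),
        has_2dim_unconditional_decomposition (linsub Y) &
        gordon_lewis (linsub Y)].
Proof.
have q1R : 1 <= q by move: q1; rewrite lee_fin.
have q0 : 0 < q by exact: lt_le_trans q1R.
have gridI a b c a' b' c' : grid a b c = grid a' b' c' -> (a, b, c) = (a', b', c').
  by move=> /(congr1 coords); rewrite !coords_grid.
have pairI (x y : nat * nat) : pickle x = pickle y -> x = y by exact: pcan_inj pickleK x y.
case: (ltgtP q 2) q2 => // [lt_q2|lt_2q] _.
- apply: (@labelled_blocks_subspace R q q1 coord_label) => C.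
  have ab : 2^-1 + (1 - q^-1) < 1.
    have : 2^-1 < q^-1 by rewrite ltf_pV2 ?posrE.
    lra.
  have [n nC] := large_power (48 * C) ab.
  exists n, grid, (n%:R `^ 2^-1), (n%:R `^ (1 - q^-1)).
  split; rewrite ?powR_ge0// => i j; split; apply: line_estimate_lt2 (ltW lt_q2) _ _ _.
  + by move=> k l _ _ /gridI[].
  + by move=> k l _ _; rewrite /coord_label /= !coords_grid.
  + move=> [[|[|[|//]]] mlt] //= _.
    * by exists i => k _; rewrite /coord_label /= coords_grid.
    * by exists j => k _; rewrite /coord_label /= coords_grid.
  + by move=> k l _ _ /gridI[].
  + by move=> k l _ _; rewrite /coord_label /= !coords_grid.
  + move=> [[|[|[|//]]] mlt] //= _.
    * by exists i => k _; rewrite /coord_label /= coords_grid.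
    * by exists j => k _; rewrite /coord_label /= coords_grid.
  + by move=> k l _ _ /gridI[].
  + by move=> k l _ _; rewrite /coord_label /= !coords_grid.
  + move=> [[|[|[|//]]] mlt] //= _.
    * by exists i => k _; rewrite /coord_label /= coords_grid.
    * by exists j => k _; rewrite /coord_label /= coords_grid.
apply: (@labelled_blocks_subspace R q q1 colabel) => C.
have ab : q^-1 + 2^-1 < 1.
  have : q^-1 < 2^-1 by rewrite ltf_pV2 ?posrE.
  lra.
have [n nC] := large_power (48 * C) ab.
exists n, grid, (n%:R `^ q^-1), (n%:R `^ 2^-1).
split; rewrite ?powR_ge0// => i j; split; apply: line_estimate_gt2 (ltW lt_2q) _ _ _.
+ by move=> k l _ _ /gridI[].
+ by exists (pickle (i, j)) => k _; rewrite /colabel /= coords_grid.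
+ move=> [[|[|[|//]]] mlt] //= _ k l _ _; rewrite /colabel /= !coords_grid;
    by move/pairI => [].
+ by move=> k l _ _ /gridI[].
+ by exists (pickle (i, j)) => k _; rewrite /colabel /= coords_grid.
+ move=> [[|[|[|//]]] mlt] //= _ k l _ _; rewrite /colabel /= !coords_grid;
    by move/pairI => [].
+ by move=> k l _ _ /gridI[].
+ by exists (pickle (i, j)) => k _; rewrite /colabel /= coords_grid.
move=> [[|[|[|//]]] mlt] //= _ k l _ _; rewrite /colabel /= !coords_grid;
  by move/pairI => [].
Qed.
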